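(* Let $\alpha\in\mathbb{C}$ be a primitive $p$-th root of unity and consider a smooth complex map (with fixed point at the origin of $\mathbb{C}^2$) of the form $$F(x,y)=\Bigl(\alpha x+\sum_{i+j\ge 2} f_{i,j}x^iy^j,\ y+\sum_{i+j\ge 2} g_{i,j}x^iy^j\Bigr).$$ Then the following are necessary conditions for $F$ to be $p$-periodic: $$\begin{aligned} &f_{1,1}=0,\qquad g_{0,2}=0,\\ &f_{1,2}\alpha-2f_{2,0}f_{0,2}+2f_{0,2}g_{1,1}-f_{1,2}=0,\\ &g_{0,3}\alpha-g_{0,3}-f_{0,2}g_{1,1}=0,\\ &f_{1,3}\alpha^2+\bigl(-2f_{2,0}f_{0,3}+3f_{0,3}g_{1,1}+2g_{1,2}f_{0,2}-2f_{2,1}f_{0,2}-2f_{1,3}\bigr)\alpha+f_{1,3}+2f_{2,0}f_{0,3}\\ &\qquad+2f_{2,1}f_{0,2}-4g_{2,0}f_{0,2}^2-2g_{1,2}f_{0,2}-3f_{0,3}g_{1,1}=0,\\ &g_{0,4}\alpha^2-\bigl(f_{0,3}g_{1,1}+2g_{0,4}+g_{1,2}f_{0,2}\bigr)\alpha+g_{2,0}f_{0,2}^2+f_{0,3}g_{1,1}+g_{0,4}+g_{1,2}f_{0,2}=0. \end{aligned}$$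
   Context: A map $F$ is called $p$-periodic if $F^p(x)=x$ for all $x$ for which $F^p$ is well defined, and $p$ is the smallest positive integer with this property. *)

(* Defs.v *)
(* Stdlib world: Stdlib's reals with Coquelicot's complex numbers [C]. *)
From Stdlib Require Import Reals.
From Coquelicot Require Import Coquelicot.

Open Scope C_scope.

(* In C_scope the product [C * C] has to be read in type_scope. *)
Definition C2 : Type := (C * C)%type.

Definition primitive_root (p : nat) (a : C) : Prop :=
  (0 < p)%nat /\ a ^ p = 1 /\
  forall m : nat, (0 < m)%nat -> (m < p)%nat -> a ^ m <> 1.

(* A partial map of C^2 is given by its domain [U] and a total function [F]
   whose values outside [U] are irrelevant: [F^n z] is well defined exactly
   when z, F z, ..., F^(n-1) z all lie in [U]. *)
Definition iter_defined (U : C2 -> Prop) (F : C2 -> C2) (n : nat) (z : C2)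
  : Prop :=
  forall k : nat, (k < n)%nat -> U (Nat.iter k F z).

Definition iter_is_identity (U : C2 -> Prop) (F : C2 -> C2) (n : nat)
  : Prop :=
  forall z : C2, iter_defined U F n z -> Nat.iter n F z = z.

Definition periodic (U : C2 -> Prop) (F : C2 -> C2) (p : nat) : Prop :=
  (0 < p)%nat /\ iter_is_identity U F p /\
  forall m : nat, (0 < m)%nat -> (m < p)%nat -> ~ iter_is_identity U F m.

(* Frechet differentiability over the field C (the differential is C-linear)
   at every point of an open set, so that F is C^infinity in the complex sense
   and analytic there. *)
Definition smooth_complex_on (U : C2 -> Prop) (F : C2 -> C2) : Prop :=
  @open (prod_UniformSpace C_UniformSpace C_UniformSpace) U /\
  forall z : C2, U z ->
    @ex_filterdiff C_AbsRing
      (prod_NormedModule C_AbsRing C_NormedModule C_NormedModule)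
      (prod_NormedModule C_AbsRing C_NormedModule C_NormedModule)
      F (@locally (prod_UniformSpace C_UniformSpace C_UniformSpace) z).

Definition homog_part (c : nat -> nat -> C) (n : nat) (x y : C) : C :=
  sum_n (fun i : nat => c i (n - i)%nat * x ^ i * y ^ (n - i)) n.

Definition homog_part_abs (c : nat -> nat -> C) (n : nat) (x y : C) : R :=
  sum_n (fun i : nat => Cmod (c i (n - i)%nat * x ^ i * y ^ (n - i))) n.

(* The double series of all c_{i,j} x^i y^j with i + j >= 2 converges (as usual
   for power series in several variables: absolutely) and has sum s. Its terms
   are grouped by total degree n + 2. The c_{i,j} with i + j < 2 are not
   used. *)
Definition is_double_series_ge2 (c : nat -> nat -> C) (x y s : C) : Prop :=
  ex_series (fun n : nat => homog_part_abs c (n + 2) x y) /\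
  is_series (fun n : nat => homog_part c (n + 2) x y) s.

Definition has_expansion_at_0 (F : C2 -> C2) (alpha : C)
  (f g : nat -> nat -> C) : Prop :=
  exists r : R, (0 < r)%R /\
    forall x y : C, (Cmod x < r)%R -> (Cmod y < r)%R ->
      exists s t : C,
        is_double_series_ge2 f x y s /\ is_double_series_ge2 g x y t /\
        F (x, y) = (alpha * x + s, y + t).

(* Main.v *)
(* Along a curve x = a2 y^2 + a3 y^3 that F fixes up to O(t^m), the iterates of
   F stay within O(t^m) of the starting point (x, y) = (curve t, t). Since F^p is
   the identity near the origin, two things follow.
   - The second components of the p displacements agree up to O(t^(m+1)) and add
     up to zero, so F fixes y up to O(t^(m+1)).
   - The p-th power of the Jacobian determinant at (curve t, t) is 1 + O(t^m), and
     the determinant is alpha at t = 0, hence it is alpha + O(t^m).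
   For m = 2, 3, 4 the coefficients of these expansions are the conditions, with
   (1 - alpha) a2 = f_{0,2} and (1 - alpha) a3 = f_{0,3}. The determinant is
   handled through finite differences of size t^m, so that only a Lipschitz bound
   on the tails of the power series is needed and not their derivatives. *)

Require Import Defs.
From Stdlib Require Import Reals Lra Lia.
From Coquelicot Require Import Coquelicot.

Open Scope C_scope.

(** * Orders of vanishing at the origin *)

(** The point [t = 0] is excluded so that a factor [t ^ k] can be cancelled later: at 0 the product
    says nothing about the other factor. *)
Definition bigO (k : nat) (h : C -> C) : Prop :=
  exists K d : R, (0 <= K)%R /\ (0 < d)%R /\
    forall t : C, t <> 0 -> (Cmod t < d)%R -> (Cmod (h t) <= K * Cmod t ^ k)%R.

Lemma bigO_ext_near (k : nat) (h1 h2 : C -> C) (d : R) :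
  (0 < d)%R -> (forall t : C, t <> 0 -> (Cmod t < d)%R -> h1 t = h2 t) ->
  bigO k h1 -> bigO k h2.
Proof.
  intros Hd He (K & d' & HK & Hd' & H).
  exists K, (Rmin d d'). split; [exact HK|]. split; [now apply Rmin_glb_lt|].
  intros t Ht Hlt. rewrite <- He; [apply H| |]; auto;
  eapply Rlt_le_trans; try exact Hlt; [apply Rmin_r | apply Rmin_l].
Qed.

Lemma bigO_ext (k : nat) (h1 h2 : C -> C) :
  (forall t : C, h1 t = h2 t) -> bigO k h1 -> bigO k h2.
Proof. intros He. apply (bigO_ext_near k h1 h2 1); [lra | auto]. Qed.

Lemma bigO_weaken (k j : nat) (h : C -> C) : bigO j h -> (k <= j)%nat -> bigO k h.
Proof.
  intros (K & d & HK & Hd & H) Hkj. exists K, (Rmin d 1).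
  split; [exact HK|]. split; [apply Rmin_glb_lt; lra|].
  intros t Ht Hlt.
  assert (Cmod t < d)%R by (eapply Rlt_le_trans; [exact Hlt | apply Rmin_l]).
  assert (Cmod t < 1)%R by (eapply Rlt_le_trans; [exact Hlt | apply Rmin_r]).
  eapply Rle_trans; [apply H; auto|]. apply Rmult_le_compat_l; [exact HK|].
  replace j with (k + (j - k))%nat by lia. rewrite pow_add.
  rewrite <- (Rmult_1_r (Cmod t ^ k)) at 2.
  pose proof (Cmod_ge_0 t).
  apply Rmult_le_compat_l; [apply pow_le; lra|].
  rewrite <- (pow1 (j - k)). apply pow_incr. lra.
Qed.

Lemma bigO_plus_same (k : nat) (h1 h2 : C -> C) :
  bigO k h1 -> bigO k h2 -> bigO k (fun t => h1 t + h2 t).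
Proof.
  intros (K1 & d1 & HK1 & Hd1 & H1) (K2 & d2 & HK2 & Hd2 & H2).
  exists (K1 + K2)%R, (Rmin d1 d2).
  split; [lra|]. split; [now apply Rmin_glb_lt|]. intros t Ht Hlt.
  assert (Cmod t < d1)%R by (eapply Rlt_le_trans; [exact Hlt | apply Rmin_l]).
  assert (Cmod t < d2)%R by (eapply Rlt_le_trans; [exact Hlt | apply Rmin_r]).
  eapply Rle_trans; [apply Cmod_triangle|]. rewrite Rmult_plus_distr_r.
  apply Rplus_le_compat; auto.
Qed.

Lemma bigO_plus (j k : nat) (h1 h2 : C -> C) :
  bigO j h1 -> bigO k h2 -> bigO (Nat.min j k) (fun t => h1 t + h2 t).
Proof.
  intros H1 H2. apply bigO_plus_same; eapply bigO_weaken; eauto; lia.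
Qed.

Lemma bigO_opp (k : nat) (h : C -> C) : bigO k h -> bigO k (fun t => - h t).
Proof.
  intros (K & d & HK & Hd & H). exists K, d. repeat split; auto.
  intros. rewrite Cmod_opp. auto.
Qed.

Lemma bigO_minus (j k : nat) (h1 h2 : C -> C) :
  bigO j h1 -> bigO k h2 -> bigO (Nat.min j k) (fun t => h1 t - h2 t).
Proof. intros. apply bigO_plus; auto. now apply bigO_opp. Qed.

Lemma bigO_mult (j k : nat) (h1 h2 : C -> C) :
  bigO j h1 -> bigO k h2 -> bigO (j + k) (fun t => h1 t * h2 t).
Proof.
  intros (K1 & d1 & HK1 & Hd1 & H1) (K2 & d2 & HK2 & Hd2 & H2).
  exists (K1 * K2)%R, (Rmin d1 d2).
  split; [now apply Rmult_le_pos|]. split; [now apply Rmin_glb_lt|]. intros t Ht Hlt.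
  assert (Cmod t < d1)%R by (eapply Rlt_le_trans; [exact Hlt | apply Rmin_l]).
  assert (Cmod t < d2)%R by (eapply Rlt_le_trans; [exact Hlt | apply Rmin_r]).
  rewrite Cmod_mult, pow_add.
  replace (K1 * K2 * (Cmod t ^ j * Cmod t ^ k))%R
    with ((K1 * Cmod t ^ j) * (K2 * Cmod t ^ k))%R by ring.
  apply Rmult_le_compat; try apply Cmod_ge_0; auto.
Qed.

Lemma bigO_const (c : C) : bigO 0 (fun _ => c).
Proof.
  exists (Cmod c), 1%R. split; [apply Cmod_ge_0|]. split; [lra|].
  intros. simpl. lra.
Qed.

Lemma bigO_id : bigO 1 (fun t => t).
Proof. exists 1%R, 1%R. repeat split; try lra. intros. simpl. lra. Qed.

Lemma bigO_pow (j k : nat) (h : C -> C) :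
  bigO j h -> bigO (k * j) (fun t => h t ^ k).
Proof.
  intros H. induction k as [|k IH]; simpl.
  - apply bigO_const.
  - now apply bigO_mult.
Qed.

Lemma bigO_zero (k : nat) : bigO k (fun _ => 0).
Proof.
  exists 0%R, 1%R. repeat split; try lra. intros. rewrite Cmod_0. lra.
Qed.

Lemma bigO_small (h : C -> C) (e : R) :
  bigO 1 h -> (0 < e)%R ->
  exists d, (0 < d)%R /\ forall t : C, t <> 0 -> (Cmod t < d)%R -> (Cmod (h t) < e)%R.
Proof.
  intros (K & d & HK & Hd & H) He. exists (Rmin d (e / (K + 1))).
  split; [apply Rmin_glb_lt; auto; apply Rdiv_lt_0_compat; lra|].
  intros t Ht Hlt.
  assert (H1 : (Cmod t < d)%R) by (eapply Rlt_le_trans; [exact Hlt | apply Rmin_l]).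
  assert (H2 : (Cmod t < e / (K + 1))%R) by (eapply Rlt_le_trans; [exact Hlt | apply Rmin_r]).
  eapply Rle_lt_trans; [apply H; auto|]. simpl. rewrite Rmult_1_r.
  apply Rmult_lt_compat_r with (r := (K + 1)%R) in H2; [|lra].
  unfold Rdiv in H2. rewrite Rmult_assoc, Rinv_l, Rmult_1_r in H2 by lra.
  pose proof (Cmod_ge_0 t). nra.
Qed.

Lemma bigO_cancel (k j : nat) (h : C -> C) :
  bigO (k + j) (fun t => h t * t ^ k) -> bigO j h.
Proof.
  intros (K & d & HK & Hd & H). exists K, d. repeat split; auto.
  intros t Ht Hlt. specialize (H t Ht Hlt).
  rewrite Cmod_mult, Cmod_pow, pow_add in H.
  assert (0 < Cmod t ^ k)%R by (apply pow_lt; now apply Cmod_gt_0).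
  apply Rmult_le_reg_r with (Cmod t ^ k)%R; auto. nra.
Qed.

Lemma bigO_const_eq_0 (c : C) : bigO 1 (fun _ => c) -> c = 0.
Proof.
  intros H. apply Cmod_eq_0. apply Rle_antisym; [|apply Cmod_ge_0].
  apply Rnot_lt_le. intros Hc.
  destruct (bigO_small _ _ H Hc) as (d & Hd & Hs).
  assert (Hm : Cmod (RtoC (d / 2)) = (d / 2)%R) by (rewrite Cmod_R, Rabs_pos_eq; lra).
  assert (RtoC (d / 2) <> 0) by (apply Cmod_gt_0; lra).
  specialize (Hs (RtoC (d / 2)) ltac:(auto) ltac:(lra)). lra.
Qed.

Lemma bigO_leading_coeff (k : nat) (c : C) (h : C -> C) :
  bigO (S k) (fun t => c * t ^ k + h t) -> bigO (S k) h -> c = 0.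
Proof.
  intros H H'. apply bigO_const_eq_0, (bigO_cancel k).
  rewrite Nat.add_1_r.
  eapply bigO_ext; [|apply bigO_plus_same; [exact H | apply bigO_opp, H']].
  intros t. simpl. ring.
Qed.

(** Near the origin [h] has modulus below [Cmod c / 2], so [c + h] has modulus at least [Cmod c / 2]
    and can be divided out. *)
Lemma bigO_cancel_unit (k : nat) (c : C) (h e : C -> C) :
  c <> 0 -> bigO 1 h -> bigO k (fun t => (c + h t) * e t) -> bigO k e.
Proof.
  intros Hc Hh (K & d & HK & Hd & H).
  assert (Hc' : (0 < Cmod c)%R) by now apply Cmod_gt_0.
  destruct (bigO_small h (Cmod c / 2) Hh ltac:(lra)) as (d' & Hd' & Hs).
  exists (K * (2 / Cmod c))%R, (Rmin d d').
  split; [apply Rmult_le_pos; auto; apply Rlt_le, Rdiv_lt_0_compat; lra|].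
  split; [now apply Rmin_glb_lt|]. intros t Ht Hlt.
  assert (H1 : (Cmod t < d)%R) by (eapply Rlt_le_trans; [exact Hlt | apply Rmin_l]).
  assert (H2 : (Cmod t < d')%R) by (eapply Rlt_le_trans; [exact Hlt | apply Rmin_r]).
  specialize (H t Ht H1). specialize (Hs t Ht H2). rewrite Cmod_mult in H.
  assert (Hl : (Cmod c / 2 <= Cmod (c + h t))%R).
  { pose proof (Cmod_triangle (c + h t) (- h t)) as T.
    replace (c + h t + - h t) with c in T by ring. rewrite Cmod_opp in T. lra. }
  apply Rmult_le_reg_l with (Cmod c / 2)%R; [lra|].
  replace (Cmod c / 2 * (K * (2 / Cmod c) * Cmod t ^ k))%R with (K * Cmod t ^ k)%R
    by (field; lra).
  pose proof (Cmod_ge_0 (e t)). nra.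
Qed.

(** Computes an order of vanishing from the syntax of the function: minimum for sums, sum for
    products. Hypotheses are tried first, and what matches nothing else is treated as a constant of
    order 0. *)
Ltac bigO_synth :=
  first [eassumption |
  match goal with
  | |- bigO _ (fun t => Cplus (@?a t) (@?b t)) => eapply (bigO_plus _ _ a b); bigO_synth
  | |- bigO _ (fun t => Cminus (@?a t) (@?b t)) => eapply (bigO_minus _ _ a b); bigO_synth
  | |- bigO _ (fun t => Copp (@?a t)) => eapply (bigO_opp _ a); bigO_synth
  | |- bigO _ (fun t => Cmult (@?a t) (@?b t)) => eapply (bigO_mult _ _ a b); bigO_synth
  | |- bigO _ (fun t => Cpow (@?a t) ?n) => eapply (bigO_pow _ n a); bigO_synth
  | |- bigO _ (fun t => t) => apply bigO_id
  | |- bigO _ (fun t => ?c) => apply (bigO_const c)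
  end].
(* [lia] alone case-splits on every [Nat.min] and blows up. *)
Ltac bigO_tac :=
  eapply bigO_weaken;
  [ bigO_synth
  | rewrite <- ?Nat.mul_min_distr_l, <- ?Nat.add_min_distr_l, <- ?Nat.add_min_distr_r;
    repeat apply Nat.min_glb; lia ].

(** The difference of the powers is [e] times a factor that tends to [p a^(p-1)], which is nonzero,
    so this factor cancels. It serves to pass from the p-th power of the Jacobian determinant to the
    determinant itself. *)
Lemma bigO_root (p m : nat) (a : C) (e : C -> C) :
  (0 < p)%nat -> a <> 0 -> bigO 1 e ->
  bigO m (fun t => (a + e t) ^ p - a ^ p) -> bigO m e.
Proof.
  intros Hp Ha He H.
  (* Binomial expansion to first order in [e], with a bounded [q] collecting the rest. For [n = 0]
     the truncated exponent [n - 1] is harmless, since [INR n] vanishes. *)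
  assert (Hq : forall n, exists q, bigO 0 q /\
            forall t : C, (a + e t) ^ n = a ^ n + (INR n * a ^ (n - 1) + e t * q t) * e t).
  { intros n. induction n as [|n (q & Hq & IH)].
    - exists (fun _ => 0). split; [apply bigO_const|]. intros. simpl. ring.
    - exists (fun t => INR n * a ^ (n - 1) + e t * q t + a * q t). split; [bigO_tac|].
      intros t. rewrite Cpow_S, IH, S_INR, RtoC_plus.
      replace (S n - 1)%nat with n by lia.
      destruct n as [|n]; simpl; [ring|]. rewrite Nat.sub_0_r. ring. }
  destruct (Hq p) as (q & Hq0 & Hqe).
  apply (bigO_cancel_unit m (INR p * a ^ (p - 1)) (fun t => e t * q t)).
  - apply Cmult_neq_0; [|now apply Cpow_nz].
    intros E. apply RtoC_inj in E. apply (not_INR p 0); [lia|exact E].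
  - bigO_tac.
  - eapply bigO_ext; [|exact H]. intros t. simpl. rewrite Hqe. ring.
Qed.

(** * Fourth-order jets and orbits *)

(** Only total degrees 2 to 4 appear: the linear part is kept apart, and no condition involves a
    coefficient of higher degree. [jet_x] and [jet_y] below are the formal partial derivatives. *)
Definition jet (c : nat -> nat -> C) (x y : C) : C :=
  c 2%nat 0%nat * x ^ 2 + c 1%nat 1%nat * x * y + c 0%nat 2%nat * y ^ 2
  + c 3%nat 0%nat * x ^ 3 + c 2%nat 1%nat * x ^ 2 * y
  + c 1%nat 2%nat * x * y ^ 2 + c 0%nat 3%nat * y ^ 3
  + c 4%nat 0%nat * x ^ 4 + c 3%nat 1%nat * x ^ 3 * y
  + c 2%nat 2%nat * x ^ 2 * y ^ 2 + c 1%nat 3%nat * x * y ^ 3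
  + c 0%nat 4%nat * y ^ 4.

Definition jet_x (c : nat -> nat -> C) (x y : C) : C :=
  2 * c 2%nat 0%nat * x + c 1%nat 1%nat * y
  + 3 * c 3%nat 0%nat * x ^ 2 + 2 * c 2%nat 1%nat * x * y + c 1%nat 2%nat * y ^ 2
  + 4 * c 4%nat 0%nat * x ^ 3 + 3 * c 3%nat 1%nat * x ^ 2 * y
  + 2 * c 2%nat 2%nat * x * y ^ 2 + c 1%nat 3%nat * y ^ 3.

Definition jet_y (c : nat -> nat -> C) (x y : C) : C :=
  c 1%nat 1%nat * x + 2 * c 0%nat 2%nat * y
  + c 2%nat 1%nat * x ^ 2 + 2 * c 1%nat 2%nat * x * y + 3 * c 0%nat 3%nat * y ^ 2
  + c 3%nat 1%nat * x ^ 3 + 2 * c 2%nat 2%nat * x ^ 2 * y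
  + 3 * c 1%nat 3%nat * x * y ^ 2 + 4 * c 0%nat 4%nat * y ^ 3.

Lemma jet_taylor (c : nat -> nat -> C) (m : nat) (x y x' y' : C -> C) :
  bigO 1 x -> bigO 1 y ->
  bigO m (fun t => x' t - x t) -> bigO m (fun t => y' t - y t) ->
  bigO (2 * m) (fun t => jet c (x' t) (y' t) - jet c (x t) (y t)
    - (jet_x c (x t) (y t) * (x' t - x t) + jet_y c (x t) (y t) * (y' t - y t))).
Proof.
  intros Hx Hy HA HB.
  set (A := fun t => x' t - x t). set (B := fun t => y' t - y t).
  fold A in HA. fold B in HB.
  (* The Taylor remainder written as a quadratic form in the increments [A] and [B], whose
     coefficients are polynomials in bounded functions. *)
  apply bigO_ext with (fun t =>
    A t * A t * (c 2%nat 0%nat + c 3%nat 0%nat * (3 * x t + A t)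
      + c 2%nat 1%nat * (y t + B t)
      + c 4%nat 0%nat * (6 * x t ^ 2 + 4 * x t * A t + A t ^ 2)
      + c 3%nat 1%nat * (3 * x t + A t) * (y t + B t)
      + c 2%nat 2%nat * (y t + B t) ^ 2)
    + A t * B t * (c 1%nat 1%nat + c 2%nat 1%nat * (2 * x t)
      + c 1%nat 2%nat * (2 * y t) + c 3%nat 1%nat * (3 * x t ^ 2)
      + c 2%nat 2%nat * (2 * x t * (2 * y t + B t)) + c 1%nat 3%nat * (3 * y t ^ 2))
    + B t * B t * (c 0%nat 2%nat + c 1%nat 2%nat * (x t + A t)
      + c 0%nat 3%nat * (3 * y t + B t) + c 2%nat 2%nat * (x t ^ 2)
      + c 1%nat 3%nat * (x t + A t) * (3 * y t + B t)
      + c 0%nat 4%nat * (6 * y t ^ 2 + 4 * y t * B t + B t ^ 2))).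
  - intros t. unfold A, B, jet, jet_x, jet_y. ring.
  - clearbody A B. bigO_tac.
Qed.

Lemma jet_x_close (c : nat -> nat -> C) (m : nat) (x y x' y' : C -> C) :
  bigO 0 x -> bigO 0 y -> bigO 0 x' -> bigO 0 y' ->
  bigO m (fun t => x' t - x t) -> bigO m (fun t => y' t - y t) ->
  bigO m (fun t => jet_x c (x' t) (y' t) - jet_x c (x t) (y t)).
Proof.
  intros Hx Hy Hx' Hy' HA HB.
  set (A := fun t => x' t - x t). set (B := fun t => y' t - y t).
  fold A in HA. fold B in HB.
  (* Each difference of monomials is split by changing [x] first and then [y], so that [A] and [B]
     factor out. *)
  apply bigO_ext with (fun t =>
    A t * (2 * c 2%nat 0%nat + 3 * c 3%nat 0%nat * (x' t + x t)
      + 2 * c 2%nat 1%nat * y t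
      + 4 * c 4%nat 0%nat * (x' t ^ 2 + x' t * x t + x t ^ 2)
      + 3 * c 3%nat 1%nat * (x' t + x t) * y t + 2 * c 2%nat 2%nat * y t ^ 2)
    + B t * (c 1%nat 1%nat + 2 * c 2%nat 1%nat * x' t
      + c 1%nat 2%nat * (y' t + y t) + 3 * c 3%nat 1%nat * x' t ^ 2
      + 2 * c 2%nat 2%nat * x' t * (y' t + y t)
      + c 1%nat 3%nat * (y' t ^ 2 + y' t * y t + y t ^ 2))).
  - intros t. unfold A, B, jet_x. ring.
  - clearbody A B. bigO_tac.
Qed.

Lemma jet_y_close (c : nat -> nat -> C) (m : nat) (x y x' y' : C -> C) :
  bigO 0 x -> bigO 0 y -> bigO 0 x' -> bigO 0 y' ->
  bigO m (fun t => x' t - x t) -> bigO m (fun t => y' t - y t) ->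
  bigO m (fun t => jet_y c (x' t) (y' t) - jet_y c (x t) (y t)).
Proof.
  intros Hx Hy Hx' Hy' HA HB.
  (* [jet_y] is [jet_x] of the transposed coefficients with the two arguments exchanged. *)
  apply bigO_ext with (fun t =>
    jet_x (fun i j => c j i) (y' t) (x' t) - jet_x (fun i j => c j i) (y t) (x t)).
  - intros t. unfold jet_x, jet_y. ring.
  - now apply jet_x_close.
Qed.

(** This models a power series starting in degree 5: on the polydisc of radius [s] it is Lipschitz
    with a constant of order [s ^ 4]. The bound replaces estimates on derivatives, and the value at
    the origin turns it into a bound on [E] itself. *)
Definition flat_remainder (E : C -> C -> C) : Prop :=
  E 0 0 = 0 /\
  exists K d : R, (0 <= K)%R /\ (0 < d)%R /\
    forall (s : R) (x y x' y' : C), (s < d)%R ->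
      (Cmod x <= s)%R -> (Cmod y <= s)%R -> (Cmod x' <= s)%R -> (Cmod y' <= s)%R ->
      (Cmod (E x' y' - E x y) <= K * s ^ 4 * (Cmod (x' - x) + Cmod (y' - y)))%R.

Lemma flat_remainder_close (E : C -> C -> C) (m : nat) (x y x' y' : C -> C) :
  flat_remainder E ->
  bigO 1 x -> bigO 1 y -> bigO 1 x' -> bigO 1 y' ->
  bigO m (fun t => x' t - x t) -> bigO m (fun t => y' t - y t) ->
  bigO (4 + m) (fun t => E (x' t) (y' t) - E (x t) (y t)).
Proof.
  intros (_ & K & d & HK & Hd & HR)
    (K1 & d1 & HK1 & Hd1 & H1) (K2 & d2 & HK2 & Hd2 & H2)
    (K3 & d3 & HK3 & Hd3 & H3) (K4 & d4 & HK4 & Hd4 & H4)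
    (K5 & d5 & HK5 & Hd5 & H5) (K6 & d6 & HK6 & Hd6 & H6).
  (* All four coordinates stay below [M * Cmod t], which is the radius [s] used in the Lipschitz
     bound; the summand 1 keeps [M] positive for the quotient [d / M]. *)
  set (M := (K1 + K2 + K3 + K4 + 1)%R).
  exists (K * M ^ 4 * (K5 + K6))%R,
    (Rmin (d / M) (Rmin d1 (Rmin d2 (Rmin d3 (Rmin d4 (Rmin d5 d6)))))).
  assert (HM : (0 < M)%R) by (unfold M; lra).
  assert (HM4 : (0 <= M ^ 4)%R) by (apply pow_le; lra).
  split; [apply Rmult_le_pos; [apply Rmult_le_pos|]; lra|].
  split; [repeat apply Rmin_glb_lt; auto; now apply Rdiv_lt_0_compat|].
  intros t Ht Hlt.
  repeat match goal with H : (_ < Rmin _ _)%R |- _ => apply Rmin_Rgt_l in H; destruct H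
  | H : (Rmin _ _ > _)%R |- _ => apply Rmin_Rgt_l in H; destruct H end.
  specialize (H1 t Ht ltac:(auto)). specialize (H2 t Ht ltac:(auto)).
  specialize (H3 t Ht ltac:(auto)). specialize (H4 t Ht ltac:(auto)).
  specialize (H5 t Ht ltac:(auto)). specialize (H6 t Ht ltac:(auto)).
  rewrite pow_1 in *. pose proof (Cmod_ge_0 t) as Hp.
  assert (HMt : (M * Cmod t < d)%R).
  { replace d with (M * (d / M))%R by (field; lra). apply Rmult_lt_compat_l; lra. }
  eapply Rle_trans.
  - apply (HR (M * Cmod t)%R); auto;
      (eapply Rle_trans; [eassumption|]); apply Rmult_le_compat_r; unfold M; lra.
  - rewrite Rpow_mult_distr, pow_add.
    replace (K * M ^ 4 * (K5 + K6) * (Cmod t ^ 4 * Cmod t ^ m))%R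
      with (K * (M ^ 4 * Cmod t ^ 4) * (K5 * Cmod t ^ m + K6 * Cmod t ^ m))%R by ring.
    apply Rmult_le_compat_l; [|lra].
    apply Rmult_le_pos; [exact HK|]. apply Rmult_le_pos; [exact HM4 | now apply pow_le].
Qed.

Definition has_jet (S : C -> C -> C) (c : nat -> nat -> C) : Prop :=
  flat_remainder (fun x y => S x y - jet c x y).

Lemma has_jet_eval (S : C -> C -> C) (c : nat -> nat -> C) (x y : C -> C) :
  has_jet S c -> bigO 1 x -> bigO 1 y ->
  bigO 5 (fun t => S (x t) (y t) - jet c (x t) (y t)).
Proof.
  intros H Hx Hy.
  pose proof (bigO_zero 1) as H0.
  (* The curve is compared with the constant curve at the origin, where the remainder vanishes; this
     gives order 4 + 1. *)
  eapply bigO_ext; [|apply (flat_remainder_close _ 1 _ _ x y H H0 H0 Hx Hy)];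
    [|apply bigO_ext with x|apply bigO_ext with y]; auto; intros t; [|ring|ring].
  cbv beta. rewrite (proj1 H). ring.
Qed.

(** The jet leaves a Taylor error of order [2 * m] and the remainder contributes order [4 + m],
    which is at least as high because [m <= 4]. *)
Lemma has_jet_incr (S : C -> C -> C) (c : nat -> nat -> C) (m : nat)
  (x y x' y' : C -> C) :
  has_jet S c -> (m <= 4)%nat ->
  bigO 1 x -> bigO 1 y -> bigO 1 x' -> bigO 1 y' ->
  bigO m (fun t => x' t - x t) -> bigO m (fun t => y' t - y t) ->
  bigO (2 * m) (fun t => S (x' t) (y' t) - S (x t) (y t)
    - (jet_x c (x t) (y t) * (x' t - x t) + jet_y c (x t) (y t) * (y' t - y t))).
Proof.
  intros H Hm Hx Hy Hx' Hy' HA HB.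
  eapply bigO_ext; [|apply bigO_plus_same;
    [exact (jet_taylor c m x y x' y' Hx Hy HA HB)
    |eapply bigO_weaken;
      [exact (flat_remainder_close _ m x y x' y' H Hx Hy Hx' Hy' HA HB) | lia]]].
  intros t. cbv beta. ring.
Qed.

Definition map_jet (F : C2 -> C2) (alpha : C) (f g : nat -> nat -> C) : Prop :=
  has_jet (fun x y => fst (F (x, y)) - alpha * x) f /\
  has_jet (fun x y => snd (F (x, y)) - y) g.

(** * Orbits along a curve of starting points *)

Definition orbit_x (F : C2 -> C2) (x y : C -> C) (n : nat) (t : C) : C :=
  fst (Nat.iter n F (x t, y t)).
Definition orbit_y (F : C2 -> C2) (x y : C -> C) (n : nat) (t : C) : C :=
  snd (Nat.iter n F (x t, y t)).

Lemma orbit_x_S (F : C2 -> C2) (x y : C -> C) (n : nat) (t : C) :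
  orbit_x F x y (S n) t = fst (F (orbit_x F x y n t, orbit_y F x y n t)).
Proof. unfold orbit_x, orbit_y. now rewrite <- surjective_pairing. Qed.

Lemma orbit_y_S (F : C2 -> C2) (x y : C -> C) (n : nat) (t : C) :
  orbit_y F x y (S n) t = snd (F (orbit_x F x y n t, orbit_y F x y n t)).
Proof. unfold orbit_x, orbit_y. now rewrite <- surjective_pairing. Qed.

Lemma map_jet_incr (F : C2 -> C2) (alpha : C) (f g : nat -> nat -> C) (m : nat)
  (x y x' y' : C -> C) :
  map_jet F alpha f g -> (m <= 4)%nat ->
  bigO 1 x -> bigO 1 y -> bigO 1 x' -> bigO 1 y' ->
  bigO m (fun t => x' t - x t) -> bigO m (fun t => y' t - y t) ->
  bigO (2 * m) (fun t => fst (F (x' t, y' t)) - fst (F (x t, y t))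
    - ((alpha + jet_x f (x t) (y t)) * (x' t - x t)
       + jet_y f (x t) (y t) * (y' t - y t))) /\
  bigO (2 * m) (fun t => snd (F (x' t, y' t)) - snd (F (x t, y t))
    - (jet_x g (x t) (y t) * (x' t - x t)
       + (1 + jet_y g (x t) (y t)) * (y' t - y t))).
Proof.
  intros [Hf Hg] Hm Hx Hy Hx' Hy' HA HB. split.
  - eapply bigO_ext; [|exact (has_jet_incr _ f m x y x' y' Hf Hm Hx Hy Hx' Hy' HA HB)].
    intros t. cbv beta. ring.
  - eapply bigO_ext; [|exact (has_jet_incr _ g m x y x' y' Hg Hm Hx Hy Hx' Hy' HA HB)].
    intros t. cbv beta. ring.
Qed.

Lemma jet_x_bigO (c : nat -> nat -> C) (x y : C -> C) :
  bigO 1 x -> bigO 1 y -> bigO 1 (fun t => jet_x c (x t) (y t)).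
Proof. intros. unfold jet_x. bigO_tac. Qed.

Lemma jet_y_bigO (c : nat -> nat -> C) (x y : C -> C) :
  bigO 1 x -> bigO 1 y -> bigO 1 (fun t => jet_y c (x t) (y t)).
Proof. intros. unfold jet_y. bigO_tac. Qed.

Lemma bigO_close (k m : nat) (x x' : C -> C) :
  bigO k x -> bigO m (fun t => x' t - x t) -> (k <= m)%nat -> bigO k x'.
Proof.
  intros Hx HA Hm.
  apply bigO_ext with (fun t => x t + (x' t - x t)); [intros; ring|].
  apply bigO_plus_same; [exact Hx | eapply bigO_weaken; eauto].
Qed.

Definition almost_fixed (F : C2 -> C2) (m : nat) (x y : C -> C) : Prop :=
  bigO 1 x /\ bigO 1 y /\
  bigO m (fun t => fst (F (x t, y t)) - x t) /\
  bigO m (fun t => snd (F (x t, y t)) - y t).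

(** By induction: the new deviation is the displacement of the base point under [F], plus a bounded
    matrix applied to the old deviation, plus an error of order [2 * m]. *)
Lemma orbit_close (F : C2 -> C2) (alpha : C) (f g : nat -> nat -> C) (m : nat)
  (x y x' y' : C -> C) :
  map_jet F alpha f g -> (1 <= m <= 4)%nat -> almost_fixed F m x y ->
  bigO m (fun t => x' t - x t) -> bigO m (fun t => y' t - y t) ->
  forall n, bigO m (fun t => orbit_x F x' y' n t - x t) /\
            bigO m (fun t => orbit_y F x' y' n t - y t).
Proof.
  intros HF Hm (Hx & Hy & H1 & H2) HA HB n.
  induction n as [|n [IHx IHy]]; [split; assumption|].
  assert (Hx' : bigO 1 (orbit_x F x' y' n)) by (apply (bigO_close 1 m x); auto; lia).
  assert (Hy' : bigO 1 (orbit_y F x' y' n)) by (apply (bigO_close 1 m y); auto; lia).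
  destruct (map_jet_incr F alpha f g m x y _ _ HF ltac:(lia) Hx Hy Hx' Hy' IHx IHy)
    as [D1 D2].
  pose proof (jet_x_bigO f x y Hx Hy). pose proof (jet_y_bigO f x y Hx Hy).
  pose proof (jet_x_bigO g x y Hx Hy). pose proof (jet_y_bigO g x y Hx Hy).
  split.
  - eapply bigO_ext; cycle 1.
    + apply bigO_plus_same; [apply bigO_plus_same; [exact H1|]|].
      * eapply bigO_weaken; [exact D1 | lia].
      * instantiate (1 := fun t => (alpha + jet_x f (x t) (y t)) * (orbit_x F x' y' n t - x t)
          + jet_y f (x t) (y t) * (orbit_y F x' y' n t - y t)).
        bigO_tac.
    + intros t. cbv beta. rewrite orbit_x_S. ring.
  - eapply bigO_ext; cycle 1.
    + apply bigO_plus_same; [apply bigO_plus_same; [exact H2|]|].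
      * eapply bigO_weaken; [exact D2 | lia].
      * instantiate (1 := fun t => jet_x g (x t) (y t) * (orbit_x F x' y' n t - x t)
          + (1 + jet_y g (x t) (y t)) * (orbit_y F x' y' n t - y t)).
        bigO_tac.
    + intros t. cbv beta. rewrite orbit_y_S. ring.
Qed.

(** * Consequences of periodicity *)

Definition periodic_near_0 (F : C2 -> C2) (p : nat) : Prop :=
  exists d : R, (0 < d)%R /\
    forall x y : C, (Cmod x < d)%R -> (Cmod y < d)%R -> Nat.iter p F (x, y) = (x, y).

Lemma orbit_return (F : C2 -> C2) (p : nat) (x y : C -> C) :
  periodic_near_0 F p -> bigO 1 x -> bigO 1 y ->
  exists d : R, (0 < d)%R /\ forall t : C, t <> 0 -> (Cmod t < d)%R ->
    orbit_x F x y p t = x t /\ orbit_y F x y p t = y t.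
Proof.
  intros (d & Hd & H) Hx Hy.
  destruct (bigO_small x d Hx Hd) as (d1 & Hd1 & H1).
  destruct (bigO_small y d Hy Hd) as (d2 & Hd2 & H2).
  exists (Rmin d1 d2). split; [now apply Rmin_glb_lt|]. intros t Ht Hlt.
  apply Rmin_Rgt_l in Hlt. destruct Hlt.
  unfold orbit_x, orbit_y. rewrite H; auto.
Qed.

(* The second component moves by almost the same amount at each iteration, and
   these [p] displacements add up to zero. *)
Lemma almost_fixed_drift (F : C2 -> C2) (alpha : C) (f g : nat -> nat -> C)
  (p m : nat) (x y : C -> C) :
  map_jet F alpha f g -> (0 < p)%nat -> periodic_near_0 F p -> (1 <= m <= 4)%nat ->
  almost_fixed F m x y -> bigO (S m) (fun t => snd (F (x t, y t)) - y t).
Proof.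
  intros HF Hp Hper Hm Hfix. pose proof Hfix as (Hx & Hy & H1 & H2).
  set (e := fun t => snd (F (x t, y t)) - y t) in *.
  assert (Z : forall h : C -> C, bigO m (fun t => h t - h t)).
  { intros h. apply bigO_ext with (fun _ => 0); [intros; ring | apply bigO_zero]. }
  pose proof (jet_x_bigO g x y Hx Hy). pose proof (jet_y_bigO g x y Hx Hy).
  (* The derivatives [jet_x g] and [jet_y g] are of order 1 and act on deviations of order [m], so
     each step adds [e] up to order [m + 1]; the quadratic error fits because [2 * m >= m + 1]. *)
  assert (Hn : forall n, bigO (S m) (fun t => orbit_y F x y n t - y t - INR n * e t)).
  { induction n as [|n IH].
    - apply bigO_ext with (fun _ => 0); [|apply bigO_zero].
      intros t. unfold orbit_y. simpl. ring.
    - destruct (orbit_close F alpha f g m x y x y HF Hm Hfix (Z x) (Z y) n) as [A B].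
      destruct (map_jet_incr F alpha f g m x y _ _ HF ltac:(lia) Hx Hy
        (bigO_close 1 m x _ Hx A ltac:(lia)) (bigO_close 1 m y _ Hy B ltac:(lia)) A B)
        as [_ D].
      eapply bigO_ext; cycle 1.
      + apply bigO_plus_same; [apply bigO_plus_same; [exact IH|]|].
        * eapply bigO_weaken; [exact D | lia].
        * instantiate (1 := fun t => jet_x g (x t) (y t) * (orbit_x F x y n t - x t)
            + jet_y g (x t) (y t) * (orbit_y F x y n t - y t)).
          bigO_tac.
      + intros t. cbv beta. rewrite orbit_y_S, S_INR, RtoC_plus. unfold e. ring. }
  destruct (orbit_return F p x y Hper Hx Hy) as (d & Hd & Hret).
  assert (Hp0 : RtoC (INR p) <> 0).
  { intros E. apply RtoC_inj in E. apply (not_INR p 0); [lia|exact E]. }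
  (* At [n = p] the orbit is back at [y], so only [p] times [e] remains, and [p] is invertible. *)
  apply (bigO_ext_near _ (fun t => - / INR p * (orbit_y F x y p t - y t - INR p * e t)) _ d).
  - exact Hd.
  - intros t Ht Hlt. destruct (Hret t Ht Hlt) as [_ ->]. field. exact Hp0.
  - specialize (Hn p). bigO_tac.
Qed.

Definition jac_det (alpha : C) (f g : nat -> nat -> C) (x y : C) : C :=
  (alpha + jet_x f x y) * (1 + jet_y g x y) - jet_y f x y * jet_x g x y.

(** The matrix is frozen at the base curve instead of following the orbit. This changes its entries
    by order [m], and since they act on differences of order [m], the error has order [2 * m], like
    the Taylor error. *)
Lemma orbit_diff_step (F : C2 -> C2) (alpha : C) (f g : nat -> nat -> C) (m n : nat)
  (x y u v : C -> C) :
  map_jet F alpha f g -> (1 <= m <= 4)%nat -> almost_fixed F m x y ->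
  bigO m (fun t => u t - x t) -> bigO m (fun t => v t - y t) ->
  let dx n t := orbit_x F u v n t - orbit_x F x y n t in
  let dy n t := orbit_y F u v n t - orbit_y F x y n t in
  bigO m (dx n) /\ bigO m (dy n) /\
  bigO (2 * m) (fun t => dx (S n) t
    - ((alpha + jet_x f (x t) (y t)) * dx n t + jet_y f (x t) (y t) * dy n t)) /\
  bigO (2 * m) (fun t => dy (S n) t
    - (jet_x g (x t) (y t) * dx n t + (1 + jet_y g (x t) (y t)) * dy n t)).
Proof.
  intros HF Hm Hfix Hu Hv dx dy. pose proof Hfix as (Hx & Hy & _ & _).
  assert (Z : forall h : C -> C, bigO m (fun t => h t - h t)).
  { intros h. apply bigO_ext with (fun _ => 0); [intros; ring | apply bigO_zero]. }
  destruct (orbit_close F alpha f g m x y x y HF Hm Hfix (Z x) (Z y) n) as [A0 B0].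
  destruct (orbit_close F alpha f g m x y u v HF Hm Hfix Hu Hv n) as [A1 B1].
  assert (Hdx : bigO m (dx n)).
  { apply bigO_ext with (fun t => (orbit_x F u v n t - x t) - (orbit_x F x y n t - x t)).
    - intros t. unfold dx. ring.
    - bigO_tac. }
  assert (Hdy : bigO m (dy n)).
  { apply bigO_ext with (fun t => (orbit_y F u v n t - y t) - (orbit_y F x y n t - y t)).
    - intros t. unfold dy. ring.
    - bigO_tac. }
  assert (Hx0 := bigO_close 1 m x _ Hx A0 ltac:(lia)).
  assert (Hy0 := bigO_close 1 m y _ Hy B0 ltac:(lia)).
  assert (Hx1 := bigO_close 1 m x _ Hx A1 ltac:(lia)).
  assert (Hy1 := bigO_close 1 m y _ Hy B1 ltac:(lia)).
  destruct (map_jet_incr F alpha f g m _ _ _ _ HF ltac:(lia) Hx0 Hy0 Hx1 Hy1 Hdx Hdy)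
    as [D1 D2].
  assert (W : forall h, bigO 1 h -> bigO 0 h) by (intros h W; eapply bigO_weaken; eauto).
  assert (Jx : forall c, bigO m (fun t => jet_x c (orbit_x F x y n t) (orbit_y F x y n t)
                                          - jet_x c (x t) (y t)))
    by (intros c; apply jet_x_close; auto).
  assert (Jy : forall c, bigO m (fun t => jet_y c (orbit_x F x y n t) (orbit_y F x y n t)
                                          - jet_y c (x t) (y t)))
    by (intros c; apply jet_y_close; auto).
  pose proof (Jx f) as Jxf. pose proof (Jx g) as Jxg.
  pose proof (Jy f) as Jyf. pose proof (Jy g) as Jyg.
  split; [exact Hdx|]. split; [exact Hdy|]. split.
  - eapply bigO_ext; cycle 1.
    + apply bigO_plus_same; [exact D1|].
      instantiate (1 := fun t =>
        (jet_x f (orbit_x F x y n t) (orbit_y F x y n t) - jet_x f (x t) (y t)) * dx n t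
        + (jet_y f (orbit_x F x y n t) (orbit_y F x y n t) - jet_y f (x t) (y t)) * dy n t).
      bigO_tac.
    + intros t. unfold dx, dy. rewrite !orbit_x_S. ring.
  - eapply bigO_ext; cycle 1.
    + apply bigO_plus_same; [exact D2|].
      instantiate (1 := fun t =>
        (jet_x g (orbit_x F x y n t) (orbit_y F x y n t) - jet_x g (x t) (y t)) * dx n t
        + (jet_y g (orbit_x F x y n t) (orbit_y F x y n t) - jet_y g (x t) (y t)) * dy n t).
      bigO_tac.
    + intros t. unfold dx, dy. rewrite !orbit_y_S. ring.
Qed.

(* Two neighbouring orbits, displaced by [t ^ m] along the two axes, span with
   the base orbit a parallelogram whose area is multiplied by [jac_det] at each
   step and returns to its initial value after [p] steps. *)
Lemma almost_fixed_jac_det (F : C2 -> C2) (alpha : C) (f g : nat -> nat -> C)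
  (p m : nat) (x y : C -> C) :
  map_jet F alpha f g -> (0 < p)%nat -> alpha ^ p = 1 -> alpha <> 0 ->
  periodic_near_0 F p -> (1 <= m <= 4)%nat -> almost_fixed F m x y ->
  bigO m (fun t => jac_det alpha f g (x t) (y t) - alpha).
Proof.
  intros HF Hp Halpha Halpha0 Hper Hm Hfix. pose proof Hfix as (Hx & Hy & _ & _).
  set (D := fun t => jac_det alpha f g (x t) (y t)).
  pose proof (jet_x_bigO f x y Hx Hy). pose proof (jet_y_bigO f x y Hx Hy).
  pose proof (jet_x_bigO g x y Hx Hy). pose proof (jet_y_bigO g x y Hx Hy).
  assert (HD : bigO 1 (fun t => D t - alpha)).
  { apply bigO_ext with (fun t => jet_x f (x t) (y t)
      + (alpha + jet_x f (x t) (y t)) * jet_y g (x t) (y t)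
      - jet_y f (x t) (y t) * jet_x g (x t) (y t)).
    - intros t. unfold D, jac_det. ring.
    - bigO_tac. }
  assert (HD0 : bigO 0 D).
  { apply bigO_ext with (fun t => alpha + (D t - alpha)); [intros; ring | bigO_tac]. }
  apply (bigO_root p m alpha); auto.
  assert (Hpow : bigO m (fun t => t ^ m)).
  { eapply bigO_weaken; [apply (bigO_pow 1 m _ bigO_id) | lia]. }
  set (xm := fun t => x t + t ^ m). set (ym := fun t => y t + t ^ m).
  assert (Z : forall h : C -> C, bigO m (fun t => h t - h t)).
  { intros h. apply bigO_ext with (fun _ => 0); [intros; ring | apply bigO_zero]. }
  assert (Hxm : bigO m (fun t => xm t - x t)).
  { apply bigO_ext with (fun t => t ^ m); [intros; unfold xm; ring | exact Hpow]. }
  assert (Hym : bigO m (fun t => ym t - y t)).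
  { apply bigO_ext with (fun t => t ^ m); [intros; unfold ym; ring | exact Hpow]. }
  set (dx1 := fun n t => orbit_x F xm y n t - orbit_x F x y n t).
  set (dy1 := fun n t => orbit_y F xm y n t - orbit_y F x y n t).
  set (dx2 := fun n t => orbit_x F x ym n t - orbit_x F x y n t).
  set (dy2 := fun n t => orbit_y F x ym n t - orbit_y F x y n t).
  set (W := fun n t => dx1 n t * dy2 n t - dx2 n t * dy1 n t).
  (* The initial area is exactly [t ^ (2 * m)]. In each step an error of order [2 * m] in one side
     meets a factor of order [m], and the earlier error is only multiplied by the bounded [D]. *)
  assert (HW : forall n, bigO (3 * m) (fun t => W n t - D t ^ n * t ^ (2 * m))).
  { induction n as [|n IH].
    - apply bigO_ext with (fun _ => 0); [|apply bigO_zero].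
      intros t. unfold W, dx1, dx2, dy1, dy2, orbit_x, orbit_y, xm, ym. simpl.
      rewrite Nat.add_0_r, Cpow_add_r. ring.
    - destruct (orbit_diff_step F alpha f g m n x y xm y HF Hm Hfix Hxm (Z y))
        as (A1 & B1 & A1' & B1').
      destruct (orbit_diff_step F alpha f g m n x y x ym HF Hm Hfix (Z x) Hym)
        as (A2 & B2 & A2' & B2').
      destruct (orbit_diff_step F alpha f g m (S n) x y xm y HF Hm Hfix Hxm (Z y))
        as (A1S & B1S & _ & _).
      destruct (orbit_diff_step F alpha f g m (S n) x y x ym HF Hm Hfix (Z x) Hym)
        as (A2S & B2S & _ & _).
      cbv beta zeta in *.
      fold (dx1 n) (dx1 (S n)) (dy1 n) (dy1 (S n))
           (dx2 n) (dx2 (S n)) (dy2 n) (dy2 (S n)) in *.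
      set (la := fun t => (alpha + jet_x f (x t) (y t)) * dx1 n t
                          + jet_y f (x t) (y t) * dy1 n t).
      set (lb := fun t => jet_x g (x t) (y t) * dx1 n t
                          + (1 + jet_y g (x t) (y t)) * dy1 n t).
      set (la' := fun t => (alpha + jet_x f (x t) (y t)) * dx2 n t
                          + jet_y f (x t) (y t) * dy2 n t).
      set (lb' := fun t => jet_x g (x t) (y t) * dx2 n t
                          + (1 + jet_y g (x t) (y t)) * dy2 n t).
      assert (E1 : bigO (2 * m) (fun t => dx1 (S n) t - la t)) by exact A1'.
      assert (E2 : bigO (2 * m) (fun t => dy1 (S n) t - lb t)) by exact B1'.
      assert (E3 : bigO (2 * m) (fun t => dx2 (S n) t - la' t)) by exact A2'.
      assert (E4 : bigO (2 * m) (fun t => dy2 (S n) t - lb' t)) by exact B2'.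
      assert (F1 : bigO m (dx1 n)) by exact A1.
      assert (F2 : bigO m (dy1 n)) by exact B1.
      assert (F3 : bigO m (dx2 n)) by exact A2.
      assert (F4 : bigO m (dy2 n)) by exact B2.
      assert (G1 : bigO m (dy2 (S n))) by exact B2S.
      assert (G2 : bigO m (dy1 (S n))) by exact B1S.
      assert (L1 : bigO m la) by (unfold la; clear - F1 F2 H H0; bigO_tac).
      assert (L3 : bigO m la') by (unfold la'; clear - F3 F4 H H0; bigO_tac).
      (* The sides are replaced by their linear images one at a time; the determinant
         [la * lb' - la' * lb] of the images is [D t * W n t]. *)
      apply bigO_ext with (fun t =>
        (dx1 (S n) t - la t) * dy2 (S n) t + la t * (dy2 (S n) t - lb' t)
        - ((dx2 (S n) t - la' t) * dy1 (S n) t + la' t * (dy1 (S n) t - lb t))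
        + D t * (W n t - D t ^ n * t ^ (2 * m))).
      + intros t. rewrite Cpow_S. unfold W, la, lb, la', lb', D, jac_det. ring.
      + clear - E1 E2 E3 E4 G1 G2 L1 L3 IH HD0. bigO_tac. }
  (* After [p] steps the area is again [t ^ (2 * m)], so [(D ^ p - 1) * t ^ (2 * m)] has order
     [3 * m], and cancelling the power of [t] leaves order [m]. *)
  apply (bigO_cancel (2 * m)).
  assert (Hxm1 : bigO 1 xm) by (apply (bigO_close 1 m x); auto; lia).
  assert (Hym1 : bigO 1 ym) by (apply (bigO_close 1 m y); auto; lia).
  destruct (orbit_return F p x y Hper Hx Hy) as (d0 & Hd0 & R0).
  destruct (orbit_return F p xm y Hper Hxm1 Hy) as (d1 & Hd1 & R1).
  destruct (orbit_return F p x ym Hper Hx Hym1) as (d2 & Hd2 & R2).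
  apply (bigO_ext_near _ (fun t => - (W p t - D t ^ p * t ^ (2 * m))) _
    (Rmin d0 (Rmin d1 d2))).
  - repeat apply Rmin_glb_lt; auto.
  - intros t Ht Hlt.
    apply Rmin_Rgt_l in Hlt. destruct Hlt as [Hlt0 Hlt].
    apply Rmin_Rgt_l in Hlt. destruct Hlt as [Hlt1 Hlt2].
    destruct (R0 t Ht Hlt0) as [X0 Y0]. destruct (R1 t Ht Hlt1) as [X1 Y1].
    destruct (R2 t Ht Hlt2) as [X2 Y2].
    cbv beta. unfold W, dx1, dx2, dy1, dy2. rewrite X0, Y0, X1, Y1, X2, Y2, Halpha.
    replace (alpha + (jac_det alpha f g (x t) (y t) - alpha)) with (D t)
      by (unfold D; ring).
    unfold xm, ym. replace (2 * m)%nat with (m + m)%nat by lia. rewrite Cpow_add_r. ring.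
  - specialize (HW p). eapply bigO_weaken; [apply bigO_opp, HW | lia].
Qed.

(** * Expansions along an almost fixed curve *)

Lemma map_jet_eval (F : C2 -> C2) (alpha : C) (f g : nat -> nat -> C) (x y : C -> C) :
  map_jet F alpha f g -> bigO 1 x -> bigO 1 y ->
  bigO 5 (fun t => fst (F (x t, y t)) - (alpha * x t + jet f (x t) (y t))) /\
  bigO 5 (fun t => snd (F (x t, y t)) - (y t + jet g (x t) (y t))).
Proof.
  intros [Hf Hg] Hx Hy. split.
  - eapply bigO_ext; [|exact (has_jet_eval _ f x y Hf Hx Hy)].
    intros t. cbv beta. ring.
  - eapply bigO_ext; [|exact (has_jet_eval _ g x y Hg Hx Hy)].
    intros t. cbv beta. ring.
Qed.

Definition curve (a2 a3 t : C) : C := a2 * t ^ 2 + a3 * t ^ 3.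

Lemma curve_bigO (a2 a3 : C) : bigO 2 (curve a2 a3).
Proof. unfold curve. bigO_tac. Qed.

(** On the curve [x] has order 2, so a monomial of bidegree (i, j) has order 2i + j; the
    coefficients listed are the only ones that contribute below order 5. The same weights govern the
    expansions of the two derivatives. *)
Lemma jet_curve (c : nat -> nat -> C) (a2 a3 : C) :
  bigO 5 (fun t => jet c (curve a2 a3 t) t
    - (c 0%nat 2%nat * t ^ 2 + (c 0%nat 3%nat + c 1%nat 1%nat * a2) * t ^ 3
       + (c 0%nat 4%nat + c 1%nat 1%nat * a3 + c 1%nat 2%nat * a2
          + c 2%nat 0%nat * a2 ^ 2) * t ^ 4)).
Proof.
  pose proof (curve_bigO a2 a3).
  apply bigO_ext with (fun t =>
    c 2%nat 0%nat * (2 * a2 * a3 + a3 ^ 2 * t) * t ^ 5 + c 1%nat 2%nat * a3 * t ^ 5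
    + c 3%nat 0%nat * curve a2 a3 t ^ 3 + c 2%nat 1%nat * curve a2 a3 t ^ 2 * t
    + c 4%nat 0%nat * curve a2 a3 t ^ 4 + c 3%nat 1%nat * curve a2 a3 t ^ 3 * t
    + c 2%nat 2%nat * curve a2 a3 t ^ 2 * t ^ 2 + c 1%nat 3%nat * curve a2 a3 t * t ^ 3).
  - intros t. unfold jet, curve. ring.
  - bigO_tac.
Qed.

Lemma jet_x_curve (c : nat -> nat -> C) (a2 a3 : C) :
  bigO 4 (fun t => jet_x c (curve a2 a3 t) t
    - (c 1%nat 1%nat * t + (c 1%nat 2%nat + 2 * c 2%nat 0%nat * a2) * t ^ 2
       + (c 1%nat 3%nat + 2 * c 2%nat 0%nat * a3 + 2 * c 2%nat 1%nat * a2) * t ^ 3)).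
Proof.
  pose proof (curve_bigO a2 a3).
  apply bigO_ext with (fun t =>
    3 * c 3%nat 0%nat * curve a2 a3 t ^ 2 + 2 * c 2%nat 1%nat * a3 * t ^ 4
    + 4 * c 4%nat 0%nat * curve a2 a3 t ^ 3 + 3 * c 3%nat 1%nat * curve a2 a3 t ^ 2 * t
    + 2 * c 2%nat 2%nat * curve a2 a3 t * t ^ 2).
  - intros t. unfold jet_x, curve. ring.
  - bigO_tac.
Qed.

Lemma jet_y_curve (c : nat -> nat -> C) (a2 a3 : C) :
  bigO 4 (fun t => jet_y c (curve a2 a3 t) t
    - (2 * c 0%nat 2%nat * t + (3 * c 0%nat 3%nat + c 1%nat 1%nat * a2) * t ^ 2
       + (4 * c 0%nat 4%nat + c 1%nat 1%nat * a3 + 2 * c 1%nat 2%nat * a2) * t ^ 3)).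
Proof.
  pose proof (curve_bigO a2 a3).
  apply bigO_ext with (fun t =>
    2 * c 1%nat 2%nat * a3 * t ^ 4 + c 2%nat 1%nat * curve a2 a3 t ^ 2
    + c 3%nat 1%nat * curve a2 a3 t ^ 3 + 2 * c 2%nat 2%nat * curve a2 a3 t ^ 2 * t
    + 3 * c 1%nat 3%nat * curve a2 a3 t * t ^ 2).
  - intros t. unfold jet_y, curve. ring.
  - bigO_tac.
Qed.

(** The two hypotheses remove the linear term, whose coefficient is f_{1,1} + 2 alpha g_{0,2}, and
    simplify the products that enter the next two coefficients. *)
Lemma jac_det_curve (alpha : C) (f g : nat -> nat -> C) (a2 a3 : C) :
  f 1%nat 1%nat = 0 -> g 0%nat 2%nat = 0 ->
  bigO 4 (fun t => jac_det alpha f g (curve a2 a3 t) t - alpha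
    - ((f 1%nat 2%nat + 2 * f 2%nat 0%nat * a2
         + alpha * (3 * g 0%nat 3%nat + g 1%nat 1%nat * a2)
         - 2 * f 0%nat 2%nat * g 1%nat 1%nat) * t ^ 2
       + (f 1%nat 3%nat + 2 * f 2%nat 0%nat * a3 + 2 * f 2%nat 1%nat * a2
         + alpha * (4 * g 0%nat 4%nat + g 1%nat 1%nat * a3 + 2 * g 1%nat 2%nat * a2)
         - 2 * f 0%nat 2%nat * (g 1%nat 2%nat + 2 * g 2%nat 0%nat * a2)
         - 3 * f 0%nat 3%nat * g 1%nat 1%nat) * t ^ 3)).
Proof.
  intros Hf Hg. pose proof (curve_bigO a2 a3) as Hc.
  assert (Hc1 : bigO 1 (curve a2 a3)) by (eapply bigO_weaken; eauto).
  pose proof (jet_x_bigO f _ _ Hc1 bigO_id). pose proof (jet_y_bigO f _ _ Hc1 bigO_id).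
  pose proof (jet_x_bigO g _ _ Hc1 bigO_id). pose proof (jet_y_bigO g _ _ Hc1 bigO_id).
  pose proof (jet_x_curve f a2 a3) as Xf. pose proof (jet_x_curve g a2 a3) as Xg.
  pose proof (jet_y_curve f a2 a3) as Yf. pose proof (jet_y_curve g a2 a3) as Yg.
  rewrite Hf in Xf, Yf. rewrite Hg in Yg.
  match type of Xf with bigO _ (fun t => _ - @?h t) => set (xf := h) in Xf end.
  match type of Xg with bigO _ (fun t => _ - @?h t) => set (xg := h) in Xg end.
  match type of Yf with bigO _ (fun t => _ - @?h t) => set (yf := h) in Yf end.
  match type of Yg with bigO _ (fun t => _ - @?h t) => set (yg := h) in Yg end.
  set (jxf := fun t => jet_x f (curve a2 a3 t) t) in *.
  set (jxg := fun t => jet_x g (curve a2 a3 t) t) in *.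
  set (jyf := fun t => jet_y f (curve a2 a3 t) t) in *.
  set (jyg := fun t => jet_y g (curve a2 a3 t) t) in *.
  assert (Xf' : bigO 4 (fun t => jxf t - xf t)) by exact Xf.
  assert (Xg' : bigO 4 (fun t => jxg t - xg t)) by exact Xg.
  assert (Yf' : bigO 4 (fun t => jyf t - yf t)) by exact Yf.
  assert (Yg' : bigO 4 (fun t => jyg t - yg t)) by exact Yg.
  assert (bigO 1 yf) by (unfold yf; bigO_tac).
  assert (bigO 0 xf) by (unfold xf; bigO_tac).
  match goal with |- bigO _ (fun t => _ - @?h t) => set (q := h) end.
  (* Each derivative is exchanged for its cubic truncation in turn; what remains is a polynomial in
     [t], shown next to be divisible by [t ^ 4]. *)
  apply bigO_ext with (fun t =>
    (jxf t - xf t) * (1 + jyg t) + (alpha + xf t) * (jyg t - yg t)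
    - ((jyf t - yf t) * jxg t + yf t * (jxg t - xg t))
    + ((alpha + xf t) * (1 + yg t) - yf t * xg t - alpha - q t)).
  - intros t. unfold jac_det, q, jxf, jxg, jyf, jyg. ring.
  - apply bigO_plus_same.
    + clearbody xf xg yf yg jxf jxg jyf jyg. clear Xf Xg Yf Yg. bigO_tac.
    + match goal with |- bigO 4 ?h => apply bigO_ext with (fun t => 
      t ^ 4 * (
       (f 1%nat 2%nat + 2 * f 2%nat 0%nat * a2
         + (f 1%nat 3%nat + 2 * f 2%nat 0%nat * a3 + 2 * f 2%nat 1%nat * a2) * t)
       * (3 * g 0%nat 3%nat + g 1%nat 1%nat * a2
       + (4 * g 0%nat 4%nat + g 1%nat 1%nat * a3 + 2 * g 1%nat 2%nat * a2) * t)
       - 2 * f 0%nat 2%nat * 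
         (g 1%nat 3%nat + 2 * g 2%nat 0%nat * a3 + 2 * g 2%nat 1%nat * a2)
       - 3 * f 0%nat 3%nat * (g 1%nat 2%nat + 2 * g 2%nat 0%nat * a2
          + (g 1%nat 3%nat + 2 * g 2%nat 0%nat * a3 + 2 * g 2%nat 1%nat * a2) * t)
       - (4 * f 0%nat 4%nat + 2 * f 1%nat 2%nat * a2) * (g 1%nat 1%nat
          + (g 1%nat 2%nat + 2 * g 2%nat 0%nat * a2) * t
       + (g 1%nat 3%nat + 2 * g 2%nat 0%nat * a3 + 2 * g 2%nat 1%nat * a2) * t ^ 2))) end.
      * intros t. unfold xf, xg, yf, yg, q. ring.
      * bigO_tac.
Qed.

Lemma bigO_cubic_eq_0 (b2 b3 : C) :
  bigO 4 (fun t => b2 * t ^ 2 + b3 * t ^ 3) -> b2 = 0 /\ b3 = 0.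
Proof.
  intros H. assert (H2 : b2 = 0).
  { apply (bigO_leading_coeff 2 _ (fun t => b3 * t ^ 3)); [|bigO_tac].
    eapply bigO_weaken; eauto. }
  split; [exact H2|]. apply (bigO_leading_coeff 3 _ (fun _ => 0)); [|apply bigO_zero].
  eapply bigO_ext; [|exact H]. intros t. cbv beta. rewrite H2. ring.
Qed.

(** * The coefficient conditions, order by order *)

Section Curve.

Context (F : C2 -> C2) (alpha : C) (f g : nat -> nat -> C) (p : nat)
  (HF : map_jet F alpha f g) (Hp : (0 < p)%nat) (Halpha : alpha ^ p = 1)
  (Halpha0 : alpha <> 0) (Hper : periodic_near_0 F p).

(** The second component is expanded one order further than the first, because the drift argument
    with [m = 4] constrains its coefficient of [t ^ 4]. *)
Lemma map_curve (a2 a3 : C) :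
  bigO 4 (fun t => fst (F (curve a2 a3 t, t)) - curve a2 a3 t
    - (((alpha - 1) * a2 + f 0%nat 2%nat) * t ^ 2
       + ((alpha - 1) * a3 + f 0%nat 3%nat + f 1%nat 1%nat * a2) * t ^ 3)) /\
  bigO 5 (fun t => snd (F (curve a2 a3 t, t)) - t
    - (g 0%nat 2%nat * t ^ 2 + (g 0%nat 3%nat + g 1%nat 1%nat * a2) * t ^ 3
       + (g 0%nat 4%nat + g 1%nat 1%nat * a3 + g 1%nat 2%nat * a2
          + g 2%nat 0%nat * a2 ^ 2) * t ^ 4)).
Proof.
  pose proof (curve_bigO a2 a3) as Hc.
  assert (Hc1 : bigO 1 (curve a2 a3)) by (eapply bigO_weaken; eauto).
  destruct (map_jet_eval F alpha f g _ _ HF Hc1 bigO_id) as [E1 E2].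
  pose proof (jet_curve f a2 a3) as Jf. pose proof (jet_curve g a2 a3) as Jg.
  split.
  - eapply bigO_ext; [|apply bigO_plus_same; [|apply bigO_plus_same;
      [eapply bigO_weaken; [exact E1 | lia] | eapply bigO_weaken; [exact Jf | lia]]]].
    + intros t. instantiate (1 := fun t => (f 0%nat 4%nat + f 1%nat 1%nat * a3
        + f 1%nat 2%nat * a2 + f 2%nat 0%nat * a2 ^ 2) * t ^ 4).
      cbv beta. unfold curve. ring.
    + bigO_tac.
  - eapply bigO_ext; [|apply bigO_plus_same; [exact E2 | exact Jg]].
    intros t. cbv beta. ring.
Qed.

Lemma almost_fixed_curve (m : nat) (a2 a3 : C) :
  bigO m (fun t => ((alpha - 1) * a2 + f 0%nat 2%nat) * t ^ 2
       + ((alpha - 1) * a3 + f 0%nat 3%nat + f 1%nat 1%nat * a2) * t ^ 3) ->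
  bigO m (fun t => g 0%nat 2%nat * t ^ 2 + (g 0%nat 3%nat + g 1%nat 1%nat * a2) * t ^ 3) ->
  (m <= 4)%nat -> almost_fixed F m (curve a2 a3) (fun t => t).
Proof.
  intros H1 H2 Hm. destruct (map_curve a2 a3) as [E1 E2].
  split; [eapply bigO_weaken; [apply curve_bigO | lia]|]. split; [apply bigO_id|]. split.
  - eapply bigO_ext; [|apply bigO_plus_same; [exact H1 | eapply bigO_weaken; [exact E1 | lia]]].
    intros t. cbv beta. ring.
  - eapply bigO_ext; [|apply bigO_plus_same; [exact H2 | apply bigO_plus_same;
      [eapply bigO_weaken; [exact E2 | lia]|]]].
    + intros t. instantiate (1 := fun t => (g 0%nat 4%nat + g 1%nat 1%nat * a3
        + g 1%nat 2%nat * a2 + g 2%nat 0%nat * a2 ^ 2) * t ^ 4).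
      cbv beta. ring.
    + bigO_tac.
Qed.

(** The axis [x = 0] is fixed up to order 2. The drift kills the quadratic term of the second
    displacement; once g_{0,2} = 0, the linear term of the determinant along the axis is f_{1,1}
    alone. *)
Lemma g02_f11_eq_0 : g 0%nat 2%nat = 0 /\ f 1%nat 1%nat = 0.
Proof.
  assert (Hfix : almost_fixed F 2 (curve 0 0) (fun t => t))
    by (apply almost_fixed_curve; [bigO_tac | bigO_tac | lia]).
  destruct (map_curve 0 0) as [_ E2].
  pose proof (almost_fixed_drift F alpha f g p 2 _ _ HF Hp Hper ltac:(lia) Hfix) as Hd.
  assert (Hg : g 0%nat 2%nat = 0).
  { match type of E2 with bigO _ ?h => apply (bigO_leading_coeff 2 _ (fun t => h t
      + (g 0%nat 3%nat * t ^ 3 + g 0%nat 4%nat * t ^ 4))) end.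
    - eapply bigO_ext; [|exact Hd]. intros t. cbv beta. ring.
    - apply bigO_plus_same; [eapply bigO_weaken; [exact E2 | lia] | bigO_tac]. }
  split; [exact Hg|].
  pose proof (almost_fixed_jac_det F alpha f g p 2 _ _ HF Hp Halpha Halpha0 Hper
    ltac:(lia) Hfix) as HD.
  pose proof (jet_x_curve f 0 0) as Xf. pose proof (jet_x_curve g 0 0) as Xg.
  assert (Hc1 : bigO 1 (curve 0 0)) by (eapply bigO_weaken; [apply curve_bigO | lia]).
  pose proof (jet_y_curve g 0 0) as Yg.
  pose proof (jet_y_bigO f _ _ Hc1 bigO_id). pose proof (jet_x_bigO f _ _ Hc1 bigO_id).
  pose proof (jet_x_bigO g _ _ Hc1 bigO_id).
  rewrite Hg in Yg.
  assert (Y2 : bigO 2 (fun t => jet_y g (curve 0 0 t) t)).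
  { eapply bigO_ext; [|apply bigO_plus_same; [eapply bigO_weaken; [exact Yg | lia]|]].
    - intros t. instantiate (1 := fun t => 3 * g 0%nat 3%nat * t ^ 2
        + 4 * g 0%nat 4%nat * t ^ 3). cbv beta. ring.
    - bigO_tac. }
  assert (X2 : bigO 2 (fun t => jet_x f (curve 0 0 t) t - f 1%nat 1%nat * t)).
  { eapply bigO_ext; [|apply bigO_plus_same; [eapply bigO_weaken; [exact Xf | lia]|]].
    - intros t. instantiate (1 := fun t => f 1%nat 2%nat * t ^ 2
        + f 1%nat 3%nat * t ^ 3). cbv beta. ring.
    - bigO_tac. }
  apply (bigO_leading_coeff 1 _ (fun t =>
    (jet_x f (curve 0 0 t) t - f 1%nat 1%nat * t)
    + (alpha + jet_x f (curve 0 0 t) t) * jet_y g (curve 0 0 t) t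
    - jet_y f (curve 0 0 t) t * jet_x g (curve 0 0 t) t)).
  - eapply bigO_ext; [|exact HD]. intros t. unfold jac_det. ring.
  - bigO_tac.
Qed.

(** The choice of [a2] cancels the quadratic term of the first displacement, so the parabola
    [a2 t^2] is fixed up to order 3 and the drift kills the cubic term of the second
    displacement. *)
Lemma g03_eq (a2 : C) :
  (1 - alpha) * a2 = f 0%nat 2%nat -> g 0%nat 3%nat + g 1%nat 1%nat * a2 = 0.
Proof.
  intros Ha2. destruct g02_f11_eq_0 as [Hg Hf].
  assert (Hfix : almost_fixed F 3 (curve a2 0) (fun t => t)).
  { apply almost_fixed_curve; [| |lia]; rewrite <- ?Ha2, ?Hg, ?Hf.
    - apply bigO_ext with (fun t => f 0%nat 3%nat * t ^ 3); [intros; ring | bigO_tac].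
    - apply bigO_ext with (fun t => (g 0%nat 3%nat + g 1%nat 1%nat * a2) * t ^ 3);
        [intros; ring | bigO_tac]. }
  destruct (map_curve a2 0) as [_ E2].
  pose proof (almost_fixed_drift F alpha f g p 3 _ _ HF Hp Hper ltac:(lia) Hfix) as Hd.
  rewrite Hg in E2.
  match type of E2 with bigO _ ?h => apply (bigO_leading_coeff 3 _ (fun t => h t
      + (g 0%nat 4%nat + g 1%nat 1%nat * 0 + g 1%nat 2%nat * a2
          + g 2%nat 0%nat * a2 ^ 2) * t ^ 4)) end.
  - eapply bigO_ext; [|exact Hd]. intros t. cbv beta. ring.
  - apply bigO_plus_same; [eapply bigO_weaken; [exact E2 | lia] | bigO_tac].
Qed.

(** With [a3] also matched and [g03_eq] at hand, the curve is fixed up to order 4. The first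
    equation is the drift at [t ^ 4]; the other two are the coefficients of [t ^ 2] and [t ^ 3] in
    the determinant. *)
Lemma fourth_order_eqs (a2 a3 : C) :
  (1 - alpha) * a2 = f 0%nat 2%nat -> (1 - alpha) * a3 = f 0%nat 3%nat ->
  g 0%nat 4%nat + g 1%nat 1%nat * a3 + g 1%nat 2%nat * a2 + g 2%nat 0%nat * a2 ^ 2 = 0 /\
  f 1%nat 2%nat + 2 * f 2%nat 0%nat * a2
    + alpha * (3 * g 0%nat 3%nat + g 1%nat 1%nat * a2)
    - 2 * f 0%nat 2%nat * g 1%nat 1%nat = 0 /\
  f 1%nat 3%nat + 2 * f 2%nat 0%nat * a3 + 2 * f 2%nat 1%nat * a2
    + alpha * (4 * g 0%nat 4%nat + g 1%nat 1%nat * a3 + 2 * g 1%nat 2%nat * a2)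
    - 2 * f 0%nat 2%nat * (g 1%nat 2%nat + 2 * g 2%nat 0%nat * a2)
    - 3 * f 0%nat 3%nat * g 1%nat 1%nat = 0.
Proof.
  intros Ha2 Ha3. destruct g02_f11_eq_0 as [Hg Hf]. pose proof (g03_eq a2 Ha2) as Hg3.
  assert (Hfix : almost_fixed F 4 (curve a2 a3) (fun t => t)).
  { apply almost_fixed_curve; [| |lia]; rewrite ?Hg3, <- ?Ha2, <- ?Ha3, ?Hg, ?Hf;
      (apply bigO_ext with (fun _ => 0); [intros; ring | apply bigO_zero]). }
  split.
  - destruct (map_curve a2 a3) as [_ E2].
    pose proof (almost_fixed_drift F alpha f g p 4 _ _ HF Hp Hper ltac:(lia) Hfix) as Hd.
    rewrite Hg, Hg3 in E2.
    match type of E2 with bigO _ ?h => apply (bigO_leading_coeff 4 _ h) end.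
    + eapply bigO_ext; [|exact Hd]. intros t. cbv beta. ring.
    + exact E2.
  - pose proof (almost_fixed_jac_det F alpha f g p 4 _ _ HF Hp Halpha Halpha0 Hper
      ltac:(lia) Hfix) as HD.
    apply bigO_cubic_eq_0.
    eapply bigO_ext; [|apply bigO_plus_same;
      [exact HD | apply bigO_opp, (jac_det_curve alpha f g a2 a3 Hf Hg)]].
    intros t. cbv beta. ring.
Qed.

(** For [p > 1] the number [1 - alpha] is invertible. For [p = 1] it is zero, but then [F] is the
    identity near the origin, which forces f_{0,2} = f_{0,3} = 0, and zero coefficients serve. *)
Lemma fixed_curve_exists :
  (forall m : nat, (0 < m)%nat -> (m < p)%nat -> alpha ^ m <> 1) ->
  exists a2 a3, (1 - alpha) * a2 = f 0%nat 2%nat /\ (1 - alpha) * a3 = f 0%nat 3%nat.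
Proof.
  intros Hprim. destruct (Nat.eq_dec p 1) as [E|E].
  - exists 0, 0. destruct (map_curve 0 0) as [E1 _].
    assert (Ha : alpha = 1) by (rewrite E, Cpow_1_r in Halpha; exact Halpha).
    assert (Hc1 : bigO 1 (curve 0 0)) by (eapply bigO_weaken; [apply curve_bigO | lia]).
    destruct (orbit_return F p _ _ Hper Hc1 bigO_id) as (d & Hd & Hret).
    rewrite !Cmult_0_r.
    destruct (bigO_cubic_eq_0 (f 0%nat 2%nat) (f 0%nat 3%nat)) as [-> ->]; [|auto].
    match type of E1 with bigO _ ?h => apply (bigO_ext_near _ (fun t => - h t) _ d) end;
      [exact Hd| |now apply bigO_opp].
    intros t Ht Hlt. destruct (Hret t Ht Hlt) as [Hr _]. rewrite E in Hr.
    unfold orbit_x in Hr. simpl in Hr. cbv beta. rewrite Hr, Ha. ring.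
  - assert (H1 : 1 - alpha <> 0).
    { intros H. apply (Hprim 1%nat); [lia|lia|]. rewrite Cpow_1_r.
      replace alpha with (1 - (1 - alpha)) by ring. rewrite H. ring. }
    exists (f 0%nat 2%nat / (1 - alpha)), (f 0%nat 3%nat / (1 - alpha)).
    split; field; exact H1.
Qed.

End Curve.

(** * From double series to jets *)

Lemma Cmod_pow_le (s : R) (x : C) (i : nat) :
  (Cmod x <= s)%R -> (Cmod (x ^ i) <= s ^ i)%R.
Proof. intros H. rewrite Cmod_pow. apply pow_incr. split; [apply Cmod_ge_0 | exact H]. Qed.

(** The Lipschitz bound of a power on the disc of radius [s], multiplied through by [s] so that the
    exponent [i - 1] does not occur. *)
Lemma Cmod_pow_minus_le (s : R) (x x' : C) (i : nat) :
  (Cmod x <= s)%R -> (Cmod x' <= s)%R ->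
  (s * Cmod (x' ^ i - x ^ i) <= INR i * s ^ i * Cmod (x' - x))%R.
Proof.
  intros Hx Hx'. pose proof (Cmod_ge_0 x) as H0.
  induction i as [|i IH].
  - simpl. replace (1 - 1) with (RtoC 0) by ring. rewrite Cmod_0. lra.
  - rewrite !Cpow_S, S_INR.
    replace (x' * x' ^ i - x * x ^ i) with (x' * (x' ^ i - x ^ i) + (x' - x) * x ^ i) by ring.
    pose proof (Cmod_triangle (x' * (x' ^ i - x ^ i)) ((x' - x) * x ^ i)) as T.
    rewrite !Cmod_mult in T. pose proof (Cmod_pow_le s x i Hx) as Hp.
    pose proof (Cmod_ge_0 (x' ^ i - x ^ i)) as P1. pose proof (Cmod_ge_0 (x' - x)) as P2.
    apply Rle_trans with (s * (s * Cmod (x' ^ i - x ^ i) + Cmod (x' - x) * s ^ i))%R.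
    + apply Rmult_le_compat_l; [lra|]. eapply Rle_trans; [exact T|].
      apply Rplus_le_compat; [apply Rmult_le_compat_r | apply Rmult_le_compat_l]; auto.
    + simpl. apply Rmult_le_compat_l with (r := s) in IH; [|lra]. lra.
Qed.

Lemma Cmod_monomial_minus_le (s : R) (x y x' y' : C) (i j : nat) :
  (Cmod x <= s)%R -> (Cmod y <= s)%R -> (Cmod x' <= s)%R -> (Cmod y' <= s)%R ->
  (s * Cmod (x' ^ i * y' ^ j - x ^ i * y ^ j)
   <= INR (i + j) * s ^ (i + j) * (Cmod (x' - x) + Cmod (y' - y)))%R.
Proof.
  intros Hx Hy Hx' Hy'. pose proof (Cmod_ge_0 x) as H0.
  replace (x' ^ i * y' ^ j - x ^ i * y ^ j)
    with ((x' ^ i - x ^ i) * y' ^ j + x ^ i * (y' ^ j - y ^ j)) by ring.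
  pose proof (Cmod_triangle ((x' ^ i - x ^ i) * y' ^ j) (x ^ i * (y' ^ j - y ^ j))) as T.
  rewrite !Cmod_mult in T.
  pose proof (Cmod_pow_minus_le s x x' i Hx Hx') as Dx.
  pose proof (Cmod_pow_minus_le s y y' j Hy Hy') as Dy.
  pose proof (Cmod_pow_le s x i Hx) as Px. pose proof (Cmod_pow_le s y' j Hy') as Py.
  pose proof (Cmod_ge_0 (x' ^ i - x ^ i)). pose proof (Cmod_ge_0 (y' ^ j - y ^ j)).
  pose proof (Cmod_ge_0 (x' - x)). pose proof (Cmod_ge_0 (y' - y)).
  pose proof (pos_INR i). pose proof (pos_INR j).
  assert (Si : (0 <= s ^ i)%R) by (apply pow_le; lra).
  assert (Sj : (0 <= s ^ j)%R) by (apply pow_le; lra).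
  apply Rle_trans with (s * Cmod (x' ^ i - x ^ i) * s ^ j + s ^ i * (s * Cmod (y' ^ j - y ^ j)))%R.
  - replace (s * Cmod (x' ^ i - x ^ i) * s ^ j + s ^ i * (s * Cmod (y' ^ j - y ^ j)))%R
      with (s * (Cmod (x' ^ i - x ^ i) * s ^ j + s ^ i * Cmod (y' ^ j - y ^ j)))%R by ring.
    apply Rmult_le_compat_l; [lra|]. eapply Rle_trans; [exact T|].
    apply Rplus_le_compat; [apply Rmult_le_compat_l | apply Rmult_le_compat_r]; auto.
  - apply Rmult_le_compat_r with (r := (s ^ j)%R) in Dx; [|exact Sj].
    apply Rmult_le_compat_l with (r := (s ^ i)%R) in Dy; [|exact Si].
    rewrite plus_INR, pow_add.
    assert (0 <= s ^ i * s ^ j)%R by now apply Rmult_le_pos.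
    assert (0 <= INR i * (s ^ i * s ^ j) * Cmod (y' - y))%R
      by (repeat apply Rmult_le_pos; auto).
    assert (0 <= INR j * (s ^ i * s ^ j) * Cmod (x' - x))%R
      by (repeat apply Rmult_le_pos; auto).
    lra.
Qed.

Lemma sum_n_minus_le (s D : R) (u u' : nat -> C) (v : nat -> R) (n : nat) :
  (0 <= s)%R ->
  (forall i, (i <= n)%nat -> (s * Cmod (u' i - u i) <= D * v i)%R) ->
  (s * Cmod (sum_n u' n - sum_n u n) <= D * sum_n v n)%R.
Proof.
  intros Hs. induction n as [|n IH]; intros H.
  - rewrite !sum_O. apply H. lia.
  - rewrite !sum_Sn.
    change (s * Cmod ((sum_n u' n + u' (S n)) - (sum_n u n + u (S n)))
            <= D * (sum_n v n + v (S n)))%R.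
    replace ((sum_n u' n + u' (S n)) - (sum_n u n + u (S n)))
      with ((sum_n u' n - sum_n u n) + (u' (S n) - u (S n))) by ring.
    pose proof (Cmod_triangle (sum_n u' n - sum_n u n) (u' (S n) - u (S n))) as T.
    apply Rmult_le_compat_l with (r := s) in T; [|exact Hs].
    specialize (IH ltac:(intros; apply H; lia)). specialize (H (S n) ltac:(lia)). lra.
Qed.

(** Rescaling from radius [rho] to radius [s] costs [(s / rho) ^ n] in degree [n], so the absolute
    sum at the single point (rho, rho) controls all coefficients of that degree. *)
Lemma homog_part_minus_le (c : nat -> nat -> C) (n : nat) (rho s : R) (x y x' y' : C) :
  (0 < rho)%R ->
  (Cmod x <= s)%R -> (Cmod y <= s)%R -> (Cmod x' <= s)%R -> (Cmod y' <= s)%R ->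
  (s * Cmod (homog_part c n x' y' - homog_part c n x y)
   <= INR n * (s / rho) ^ n * (Cmod (x' - x) + Cmod (y' - y))
      * homog_part_abs c n rho rho)%R.
Proof.
  intros Hr Hx Hy Hx' Hy'. pose proof (Cmod_ge_0 x) as H0.
  apply sum_n_minus_le; [lra|]. intros i Hi.
  replace (c i (n - i)%nat * x' ^ i * y' ^ (n - i) - c i (n - i)%nat * x ^ i * y ^ (n - i))
    with (c i (n - i)%nat * (x' ^ i * y' ^ (n - i) - x ^ i * y ^ (n - i))) by ring.
  pose proof (Cmod_monomial_minus_le s x y x' y' i (n - i) Hx Hy Hx' Hy') as D.
  replace (i + (n - i))%nat with n in D by lia.
  rewrite !Cmod_mult, !Cmod_pow, Cmod_R, (Rabs_pos_eq rho) by lra.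
  rewrite (Rmult_assoc (Cmod (c i _))), <- pow_add.
  replace (i + (n - i))%nat with n by lia.
  unfold Rdiv. rewrite Rpow_mult_distr, pow_inv.
  pose proof (Cmod_ge_0 (c i (n - i)%nat)) as Pc.
  apply Rmult_le_compat_l with (r := Cmod (c i (n - i)%nat)) in D; [|exact Pc].
  assert (rho ^ n <> 0)%R by (apply pow_nonzero; lra).
  match goal with |- (_ <= ?b)%R => replace b with (Cmod (c i (n - i)%nat)
    * (INR n * s ^ n * (Cmod (x' - x) + Cmod (y' - y))))%R by (field; auto) end.
  lra.
Qed.

(** The partial sums stay below [B * (2 - (1 / 2) ^ n)] by induction, and the bound passes to the
    limit. *)
Lemma is_series_geom_le (a : nat -> C) (l : C) (B : R) :
  is_series a l -> (forall k, (Cmod (a k) <= B * (1 / 2) ^ k)%R) ->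
  (Cmod l <= 2 * B)%R.
Proof.
  intros Hs Ha.
  assert (HN : forall n, (Cmod (sum_n a n) <= B * (2 - (1 / 2) ^ n))%R).
  { induction n as [|n IH].
    - rewrite sum_O. specialize (Ha 0%nat). simpl in *. lra.
    - rewrite sum_Sn. change (Cmod (sum_n a n + a (S n)) <= B * (2 - (1 / 2) ^ S n))%R.
      eapply Rle_trans; [apply Cmod_triangle|]. specialize (Ha (S n)). simpl in *. lra. }
  assert (HB : (0 <= B)%R).
  { specialize (Ha 0%nat). simpl in Ha. pose proof (Cmod_ge_0 (a 0%nat)). lra. }
  apply le_epsilon. intros eps Heps.
  pose proof (proj1 (filterlim_locally_ball_norm (sum_n a) l) Hs) as L.
  specialize (L (mkposreal eps Heps)). destruct L as [N L].
  specialize (L N (le_n N)). unfold ball_norm in L. simpl in L.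
  change (Cmod (sum_n a N - l) < eps)%R in L.
  pose proof (Cmod_triangle (sum_n a N) (- (sum_n a N - l))) as T.
  replace (sum_n a N + - (sum_n a N - l)) with l in T by ring.
  rewrite Cmod_opp in T. specialize (HN N).
  assert (0 <= B * (1 / 2) ^ N)%R by (apply Rmult_le_pos; [exact HB | apply pow_le; lra]).
  lra.
Qed.

Lemma homog_part_0 (c : nat -> nat -> C) (n : nat) : homog_part c (S n) 0 0 = 0.
Proof.
  unfold homog_part. rewrite (sum_n_ext _ (fun _ => zero)).
  - exact (sum_n_m_const_zero 0 (S n)).
  - intros i. change (c i (S n - i)%nat * 0 ^ i * 0 ^ (S n - i) = 0).
    destruct i; simpl; ring.
Qed.

Lemma homog_parts_jet (c : nat -> nat -> C) (x y : C) :
  homog_part c 2 x y + homog_part c 3 x y + homog_part c 4 x y = jet c x y.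
Proof.
  unfold homog_part, jet. rewrite !sum_Sn, !sum_O. unfold plus. simpl. ring.
Qed.

(** The tail from degree 5 on is dominated by a geometric series: for [s < rho / 4] the factor
    [(s / rho) ^ n] outweighs the degree [n] that the Lipschitz bound brings in. *)
Lemma double_series_has_jet (S : C -> C -> C) (c : nat -> nat -> C) (r : R) :
  (0 < r)%R ->
  (forall x y : C, (Cmod x < r)%R -> (Cmod y < r)%R -> is_double_series_ge2 c x y (S x y)) ->
  has_jet S c.
Proof.
  intros Hr H.
  set (rho := (r / 2)%R). assert (Hrho : (0 < rho)%R) by (unfold rho; lra).
  assert (Hmod : (Cmod rho < r)%R) by (rewrite Cmod_R, Rabs_pos_eq; unfold rho; lra).
  destruct (H rho rho Hmod Hmod) as [Habs _].
  (* The terms of the convergent absolute series tend to zero and hence are bounded. *)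
  destruct (filterlim_bounded (fun n => homog_part_abs c (n + 2) rho rho)) as [M HM].
  { exists 0%R. exact (ex_series_lim_0 _ Habs). }
  assert (HM' : forall n, (homog_part_abs c (n + 2) rho rho <= M)%R).
  { intros n. eapply Rle_trans; [apply Rle_abs | exact (HM n)]. }
  assert (HM0 : (0 <= M)%R) by (eapply Rle_trans; [apply Rabs_pos | exact (HM 0%nat)]).
  split.
  - destruct (H 0 0) as [_ H0]; [rewrite Cmod_0; lra | rewrite Cmod_0; lra|].
    assert (E : S 0 0 = 0).
    { apply Cmod_eq_0, Rle_antisym; [|apply Cmod_ge_0].
      apply Rle_trans with (2 * 0)%R; [|lra].
      apply (is_series_geom_le _ _ _ H0). intros k.
      rewrite Nat.add_succ_r, homog_part_0, Cmod_0. lra. }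
    rewrite E. unfold jet. ring.
  (* The 2 is the sum of the geometric series of ratio 1/2, and [5 * M / rho ^ 5] comes from its
     first term, in degree 5. *)
  - exists (2 * (5 * M / rho ^ 5))%R, (rho / 4)%R.
    assert (Hr5 : (0 < rho ^ 5)%R) by now apply pow_lt.
    split; [apply Rmult_le_pos; [lra|]; apply Rmult_le_pos;
            [lra | apply Rlt_le, Rinv_0_lt_compat; exact Hr5]|].
    split; [lra|]. intros s x y x' y' Hs Hx Hy Hx' Hy'.
    assert (Hs0 : (0 <= s)%R) by (eapply Rle_trans; [apply Cmod_ge_0 | exact Hx]).
    (* The main estimate is divided by [s], so [s = 0] is treated apart. *)
    destruct (Req_dec s 0) as [Es|Es].
    { assert (Z : forall z, (Cmod z <= s)%R -> z = 0).
      { intros z Hz. apply Cmod_eq_0. pose proof (Cmod_ge_0 z). lra. }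
      rewrite (Z x), (Z y), (Z x'), (Z y'), Es by auto.
      replace (S 0 0 - jet c 0 0 - (S 0 0 - jet c 0 0)) with (RtoC 0) by ring.
      rewrite Cmod_0. simpl. lra. }
    assert (Hsr : (s < r)%R) by (unfold rho in Hs; lra).
    destruct (H x y) as [_ Sx]; try lra. destruct (H x' y') as [_ Sx']; try lra.
    pose proof (is_series_minus _ _ _ _ Sx' Sx) as Sd.
    set (a := fun n => homog_part c (n + 2) x' y' - homog_part c (n + 2) x y).
    (* Index [n] stands for degree [n + 2], so dropping three terms removes degrees 2, 3 and 4, that
       is, the jet. *)
    assert (Sa : is_series (fun k => a (3 + k)%nat)
      (S x' y' - jet c x' y' - (S x y - jet c x y))).
    { apply is_series_incr_n; [lia|].
      refine (eq_ind _ (is_series a) Sd _ _).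
      change (S x' y' - S x y =
        (S x' y' - jet c x' y' - (S x y - jet c x y)) + sum_n a 2).
      rewrite <- !homog_parts_jet, !sum_Sn, sum_O. unfold a, plus. simpl. ring. }
    set (Dl := (Cmod (x' - x) + Cmod (y' - y))%R).
    assert (HDl : (0 <= Dl)%R)
      by (apply Rplus_le_le_0_compat; apply Cmod_ge_0).
    replace (2 * (5 * M / rho ^ 5) * s ^ 4 * Dl)%R
      with (2 * (5 * M / rho ^ 5 * s ^ 4 * Dl))%R by ring.
    apply (is_series_geom_le _ _ _ Sa). intros k. unfold a.
    apply Rmult_le_reg_l with s; [lra|].
    eapply Rle_trans; [apply (homog_part_minus_le c _ rho); auto|]. fold Dl.
    replace (s * (5 * M / rho ^ 5 * s ^ 4 * Dl * (1 / 2) ^ k))%R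
      with (5 * (s / rho) ^ 5 * (1 / 2) ^ k * Dl * M)%R by (field; lra).
    assert (Hq : (0 <= s / rho <= 1 / 4)%R).
    { split.
      - apply Rmult_le_pos; [lra | apply Rlt_le, Rinv_0_lt_compat; exact Hrho].
      - apply Rmult_le_reg_r with rho; [exact Hrho|].
        unfold Rdiv. rewrite Rmult_assoc, Rinv_l by lra. lra. }
    assert (Hq5 : (0 <= (s / rho) ^ 5)%R) by (apply pow_le; lra).
    (* The degree [k + 5] grows at most like [5 * 2 ^ k]; against [(1 / 4) ^ k] this leaves ratio
       1/2. *)
    assert (Hk : (0 <= INR (3 + k + 2) <= 5 * 2 ^ k)%R).
    { split; [apply pos_INR|]. clear. induction k as [|k IH].
      - simpl. lra.
      - replace (3 + S k + 2)%nat with (Datatypes.S (3 + k + 2)) by lia.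
        rewrite S_INR. simpl (2 ^ Datatypes.S k)%R.
        assert (1 <= 2 ^ k)%R by (apply pow_R1_Rle; lra). lra. }
    assert (Hp : (INR (3 + k + 2) * (s / rho) ^ (3 + k + 2)
                  <= 5 * (s / rho) ^ 5 * (1 / 2) ^ k)%R).
    { replace ((s / rho) ^ (3 + k + 2))%R with ((s / rho) ^ 5 * (s / rho) ^ k)%R
        by (rewrite <- pow_add; f_equal; lia).
      replace (5 * (s / rho) ^ 5 * (1 / 2) ^ k)%R
        with (5 * 2 ^ k * ((s / rho) ^ 5 * (1 / 4) ^ k))%R.
      - apply Rmult_le_compat; [apply Hk | |apply Hk|].
        + apply Rmult_le_pos; [exact Hq5 | apply pow_le; lra].
        + apply Rmult_le_compat_l; [exact Hq5 | apply pow_incr; exact Hq].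
      - replace (1 / 2)%R with (2 * (1 / 4))%R by field. rewrite Rpow_mult_distr. ring. }
    assert (Hn : (0 <= INR (3 + k + 2) * (s / rho) ^ (3 + k + 2))%R)
      by (apply Rmult_le_pos; [apply Hk | apply pow_le; lra]).
    apply Rmult_le_compat; [now apply Rmult_le_pos | | |apply HM'].
    + unfold homog_part_abs. apply Rle_trans with (sum_n (fun _ => 0%R) (3 + k + 2)).
      * right. symmetry. exact (sum_n_m_const_zero 0 (3 + k + 2)).
      * apply sum_n_m_le. intros i. apply Cmod_ge_0.
    + now apply Rmult_le_compat_r.
Qed.

(** * From partial maps to iterates near the origin *)

(** Differentiability makes [F] continuous at its fixed point, so every iterate tends to [z0] as its
    argument does; finitely many of them therefore lie in the open set [U] at once. *)
Lemma iter_defined_locally (U : C2 -> Prop) (F : C2 -> C2) (z0 : C2) (n : nat) :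
  smooth_complex_on U F -> U z0 -> F z0 = z0 ->
  @locally (prod_UniformSpace C_UniformSpace C_UniformSpace) z0 (iter_defined U F n).
Proof.
  intros [Hopen Hdiff] HU Hfix.
  set (loc := @locally (prod_UniformSpace C_UniformSpace C_UniformSpace) z0).
  pose proof (filterdiff_continuous (K := C_AbsRing)
    (U := prod_NormedModule C_AbsRing C_NormedModule C_NormedModule)
    (V := prod_NormedModule C_AbsRing C_NormedModule C_NormedModule) F z0 (Hdiff z0 HU)) as Hc.
  unfold continuous in Hc. rewrite Hfix in Hc.
  assert (Hit : forall k, filterlim (Nat.iter k F) loc loc).
  { induction k as [|k IH]; [apply filterlim_id|].
    exact (filterlim_comp _ _ _ (Nat.iter k F) F loc loc loc IH Hc). }
  induction n as [|n IH].
  - apply filter_forall. intros z k Hk. lia.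
  - generalize (filter_and _ _ IH (Hit n U (Hopen z0 HU))). apply filter_imp.
    intros z [H1 H2] k Hk.
    destruct (Nat.eq_dec k n) as [->|Hne]; [exact H2 | apply H1; lia].
Qed.

Lemma periodic_near_origin (U : C2 -> Prop) (F : C2 -> C2) (p : nat) :
  smooth_complex_on U F -> U (RtoC 0, RtoC 0) -> F (RtoC 0, RtoC 0) = (RtoC 0, RtoC 0) ->
  periodic U F p -> periodic_near_0 F p.
Proof.
  intros Hs HU Hfix (_ & Hper & _).
  destruct (iter_defined_locally U F _ p Hs HU Hfix) as [eps Heps].
  exists eps. split; [apply cond_pos|]. intros x y Hx Hy.
  apply Hper, Heps.
  split; apply C_NormedModule_mixin_compat1; unfold minus, plus, opp; simpl.
  - now replace (x + - 0) with x by ring.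
  - now replace (y + - 0) with y by ring.
Qed.

Lemma expansion_map_jet (F : C2 -> C2) (alpha : C) (f g : nat -> nat -> C) :
  has_expansion_at_0 F alpha f g -> map_jet F alpha f g.
Proof.
  intros (r & Hr & H). split; apply double_series_has_jet with r; auto;
    intros x y Hx Hy; destruct (H x y Hx Hy) as (s & t & Hs & Ht & ->); simpl.
  - now replace (alpha * x + s - alpha * x) with s by ring.
  - now replace (y + t - y) with t by ring.
Qed.

Lemma map_jet_origin (F : C2 -> C2) (alpha : C) (f g : nat -> nat -> C) :
  map_jet F alpha f g -> F (RtoC 0, RtoC 0) = (RtoC 0, RtoC 0).
Proof.
  intros [[Hf _] [Hg _]]. rewrite (surjective_pairing (F (RtoC 0, RtoC 0))).
  f_equal.
  - transitivity (fst (F (RtoC 0, RtoC 0)) - alpha * 0 - jet f 0 0); [unfold jet; ring | exact Hf].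
  - transitivity (snd (F (RtoC 0, RtoC 0)) - 0 - jet g 0 0); [unfold jet; ring | exact Hg].
Qed.

Theorem theorem2 (p : nat) (alpha : C) (U : C2 -> Prop) (F : C2 -> C2)
  (f g : nat -> nat -> C)
  (Halpha : primitive_root p alpha)
  (HU0 : U (RtoC 0, RtoC 0))
  (Hsmooth : smooth_complex_on U F)
  (Hform : has_expansion_at_0 F alpha f g)
  (Hper : periodic U F p) :
  f 1%nat 1%nat = 0 /\
  g 0%nat 2%nat = 0 /\
  f 1%nat 2%nat * alpha - 2 * f 2%nat 0%nat * f 0%nat 2%nat
    + 2 * f 0%nat 2%nat * g 1%nat 1%nat - f 1%nat 2%nat = 0 /\
  g 0%nat 3%nat * alpha - g 0%nat 3%nat - f 0%nat 2%nat * g 1%nat 1%nat = 0 /\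
  f 1%nat 3%nat * alpha ^ 2
    + (- (2) * f 2%nat 0%nat * f 0%nat 3%nat
       + 3 * f 0%nat 3%nat * g 1%nat 1%nat
       + 2 * g 1%nat 2%nat * f 0%nat 2%nat
       - 2 * f 2%nat 1%nat * f 0%nat 2%nat
       - 2 * f 1%nat 3%nat) * alpha
    + f 1%nat 3%nat
    + 2 * f 2%nat 0%nat * f 0%nat 3%nat
    + 2 * f 2%nat 1%nat * f 0%nat 2%nat
    - 4 * g 2%nat 0%nat * f 0%nat 2%nat ^ 2
    - 2 * g 1%nat 2%nat * f 0%nat 2%nat
    - 3 * f 0%nat 3%nat * g 1%nat 1%nat = 0 /\
  g 0%nat 4%nat * alpha ^ 2
    - (f 0%nat 3%nat * g 1%nat 1%nat + 2 * g 0%nat 4%nat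
       + g 1%nat 2%nat * f 0%nat 2%nat) * alpha
    + g 2%nat 0%nat * f 0%nat 2%nat ^ 2
    + f 0%nat 3%nat * g 1%nat 1%nat
    + g 0%nat 4%nat
    + g 1%nat 2%nat * f 0%nat 2%nat = 0.
Proof.
  destruct Halpha as (Hp & Hroot & Hprim).
  assert (HF := expansion_map_jet F alpha f g Hform).
  assert (Hnear := periodic_near_origin U F p Hsmooth HU0 (map_jet_origin _ _ _ _ HF) Hper).
  assert (Ha0 : alpha <> 0).
  { intros E. rewrite E in Hroot. destruct p as [|q]; [lia|].
    rewrite Cpow_S, Cmult_0_l in Hroot. apply RtoC_inj in Hroot. lra. }
  destruct (g02_f11_eq_0 F alpha f g p HF Hp Hroot Ha0 Hnear) as [Hg02 Hf11].
  destruct (fixed_curve_exists F alpha f g p HF Hp Hroot Hnear Hprim) as (a2 & a3 & H2 & H3).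
  pose proof (g03_eq F alpha f g p HF Hp Hroot Ha0 Hnear a2 H2) as H03.
  destruct (fourth_order_eqs F alpha f g p HF Hp Hroot Ha0 Hnear a2 a3 H2 H3)
    as (H04 & H12 & H13).
  split; [exact Hf11|]. split; [exact Hg02|].
  (* Expressing f_{0,2} and f_{0,3} through [a2] and [a3] avoids dividing by [1 - alpha], so
     [alpha = 1] needs no separate treatment here. *)
  rewrite <- H2, <- H3 in *.
  assert (E03 : g 0%nat 3%nat = - (g 1%nat 1%nat * a2)).
  { transitivity (g 0%nat 3%nat + g 1%nat 1%nat * a2 - g 1%nat 1%nat * a2);
      [ring | rewrite H03; ring]. }
  set (b4 := g 1%nat 1%nat * a3 + g 1%nat 2%nat * a2 + g 2%nat 0%nat * a2 ^ 2) in *.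
  assert (E04 : g 0%nat 4%nat = - b4).
  { transitivity (g 0%nat 4%nat + g 1%nat 1%nat * a3 + g 1%nat 2%nat * a2
      + g 2%nat 0%nat * a2 ^ 2 - b4); [unfold b4; ring | rewrite H04; ring]. }
  rewrite E03 in *. rewrite E04 in *.
  repeat split.
  (* This condition is [alpha - 1] times [H12]. The one on f_{1,3} is [(alpha - 1) ^ 2] times [H13],
     and the two on g_{0,3} and g_{0,4} are identities after the substitutions. *)
  - rewrite <- (Cmult_0_r (alpha - 1)), <- H12. ring.
  - ring.
  - rewrite <- (Cmult_0_r ((alpha - 1) ^ 2)), <- H13. unfold b4. ring.
  - unfold b4. ring.
Qed.
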